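(* Let $\mathbb{K}$ be a field and $t\in\mathbb{K}$ such that the following 19 points of $\mathbf{P}^2(\mathbb{K})$ are distinct: $$A=[0:0:1],\quad B=[0:1:0],\quad C=[1:0:0],\quad D=[0:1:1],\quad E=[1:0:1],\quad F=[1:t:0],$$ $$G=[1:t:1],\quad H=[1:t+1:1],\quad I_0=[1:0:-t],\quad J=[1:t:t+1],\quad K=[1:-1:0],$$ $$L=[0:1:-t],\quad M=[1:0:t^2+t+1],\quad N=[t:t^2+t+1:0],\quad O=[t:-(t+1):t],$$ $$P=[1:t:-(t^2+t)],\quad Q=[0:-1:t+1],\quad R_0=[t+2:t^2+2t+1:1],\quad S=[t+2:-1:t+1].$$ Let $Z$ be the set of these 19 points and let $I\subset\mathbb{K}[x,y,z]$ be the homogeneous ideal of $Z$. Suppose that $\alpha(I)=\omega(I)=5$, $\operatorname{reg}(I)=7$ and $I^{(3)}\not\subseteq I^2$. Then $$\rho(I)=\frac{3}{2}\quad\text{and}\quad \widehat{\rho}(I)=\frac{5}{4}.$$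
   Context: Let $R=\mathbb{K}[x,y,z]$ with its standard grading, the homogeneous coordinate ring of $\mathbf{P}^2$ over the field $\mathbb{K}$, and let $(0)\neq I\subsetneq R$ be a homogeneous ideal. $\alpha(I)$ is the least degree of a nonzero homogeneous element of $I$; $\omega(I)$ is the maximum among the degrees of a minimal set of homogeneous generators of $I$; $\operatorname{reg}(I)$ is the Castelnuovo–Mumford regularity of $I$ (as a graded $R$-module). The ideal of a finite set $Z=\{p_1,\dots,p_k\}$ of points is the ideal generated by all homogeneous polynomials vanishing on $Z$, i.e. $I=\bigcap_i I_{p_i}$, where $I_{p_i}$ is the ideal of the point $p_i$. Its $m$-th symbolic power is $I^{(m)}=\bigcap_i I_{p_i}^m$. The resurgence of $I$ is $$\rho(I)=\sup\Big\{\frac{m}{r}: I^{(m)}\not\subseteq I^r\Big\},$$ and the asymptotic resurgence of $I$ is $$\widehat{\rho}(I)=\sup\Big\{\frac{m}{r}: I^{(mt')}\not\subseteq I^{rt'}\ \text{ for all integers } t'\gg 0\Big\},$$ where $m,r$ range over positive integers. *)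

(* Defs.v *)
From mathcomp Require Import all_boot all_order all_algebra.
From mathcomp Require Import boolp classical_sets reals.
From mathcomp Require Import mpoly.
Set Implicit Arguments.
Unset Strict Implicit.
Unset Printing Implicit Defensive.
Import Order.TTheory GRing.Theory Num.Theory.
Local Open Scope classical_set_scope.
Local Open Scope ring_scope.

(* Ideals of {mpoly K[n]} are represented by their sets of elements. *)
Definition ideal_gen (n : nat) (K : fieldType) (G : set {mpoly K[n]}) :
    set {mpoly K[n]} :=
  [set f | exists (k : nat) (c g : 'I_k -> {mpoly K[n]}),
     (forall i, G (g i)) /\ f = \sum_(i < k) c i * g i].

(* For r = 0 the empty product makes this the unit ideal. *)
Definition ideal_pow (n : nat) (K : fieldType) (I : set {mpoly K[n]})
    (r : nat) : set {mpoly K[n]} :=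
  ideal_gen [set f | exists g : 'I_r -> {mpoly K[n]},
     (forall i, I (g i)) /\ f = \prod_(i < r) g i].

(* The least degree of a nonzero form of I; the value 0 returned when I has
   no nonzero form is a default. *)
Definition alpha (n : nat) (K : fieldType) (I : set {mpoly K[n]}) : nat :=
  xget 0%N [set d |
    (exists f, [/\ I f, f != 0 & f \is d.-homog]) /\
    (forall e f, I f -> f != 0 -> f \is e.-homog -> (d <= e)%N)].

(* A finite family of homogeneous generators, of degrees e, none of which
   can be omitted. *)
Definition min_hom_generators (n : nat) (K : fieldType)
    (I : set {mpoly K[n]}) (k : nat) (g : 'I_k -> {mpoly K[n]})
    (e : 'I_k -> nat) : Prop :=
  [/\ forall i, g i \is (e i).-homog,
      ideal_gen (range g) = I
    & forall j, ideal_gen (g @` [set i | i <> j]) <> I].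

(* The set below has at most one element: the degrees of a minimal set of
   homogeneous generators do not depend on its choice. *)
Definition omega (n : nat) (K : fieldType) (I : set {mpoly K[n]}) : nat :=
  xget 0%N [set d | exists (k : nat) (g : 'I_k -> {mpoly K[n]})
                           (e : 'I_k -> nat),
    min_hom_generators I g e /\ d = (\max_(i < k) e i)%N].

(* A minimal graded free resolution ... -> F_1 -> F_0 -> I -> 0, where
   F_i is the direct sum over p < rk i of the S(- shift i p), S = K[x_0, ...].
   Elements of F_i are row vectors and the maps act by right multiplication.
   Minimality: the entries of the matrices diff i : F_(i+1) -> F_i have no
   constant term. *)
Record min_free_resolution (n : nat) (K : fieldType)
    (I : set {mpoly K[n]}) := MinFreeResolution {
  rk : nat -> nat;
  shift : forall i, 'I_(rk i) -> nat;
  augm : 'cV[{mpoly K[n]}]_(rk 0);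
  diff : forall i, 'M[{mpoly K[n]}]_(rk i.+1, rk i);
  augm_homog : forall p, augm p 0 \is (shift p).-homog;
  diff_homog : forall i p q, diff i p q = 0 \/
    exists2 k, (shift q + k)%N = shift p & diff i p q \is k.-homog;
  diff_minimal : forall i p q, (diff i p q)@_0%MM = 0;
  augm_image : forall f, I f <-> exists u : 'rV_(rk 0), f = (u *m augm) 0 0;
  augm_exact : forall u : 'rV_(rk 0),
    u *m augm = 0 <-> exists v : 'rV_(rk 1), u = v *m diff 0;
  diff_exact : forall i (u : 'rV_(rk i.+1)),
    u *m diff i = 0 <-> exists v : 'rV_(rk i.+2), u = v *m diff i.+1 }.

(* Castelnuovo-Mumford regularity: the maximum of (shift i p) - i over a
   minimal graded free resolution, which is unique up to isomorphism. *)
Definition regularity (n : nat) (K : fieldType) (I : set {mpoly K[n]}) : nat :=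
  xget 0%N [set d | exists F : min_free_resolution I,
    (forall i (p : 'I_(rk F i)), (shift p <= d + i)%N) /\
    (exists i (p : 'I_(rk F i)), shift p = (d + i)%N)].

(* Points of projective space are given by row vectors v != 0 of homogeneous
   coordinates; the point itself is the line spanned by v, and <<v>>%MS is the
   canonical representative of that line. *)
Definition distinct_points (n : nat) (K : fieldType) (Z : seq 'rV[K]_n) : bool :=
  uniq [seq <<v>>%MS | v <- Z].

(* The ideal generated by the forms that vanish on Z. *)
Definition points_ideal (n : nat) (K : fieldType) (Z : seq 'rV[K]_n) :
    set {mpoly K[n]} :=
  ideal_gen [set f | (exists d, f \is d.-homog) /\
                     (forall v, v \in Z -> f.@[v 0] = 0)].

Definition symbolic_pow (n : nat) (K : fieldType) (Z : seq 'rV[K]_n)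
    (m : nat) : set {mpoly K[n]} :=
  [set f | forall v, v \in Z -> ideal_pow (points_ideal [:: v]) m f].

(* sup is the real supremum; its default value, for a set that is empty or
   unbounded, is 0. *)
Definition resurgence (R : realType) (n : nat) (K : fieldType)
    (Z : seq 'rV[K]_n) : R :=
  sup [set q : R | exists m r : nat, [/\ (0 < m)%N, (0 < r)%N,
    ~ (symbolic_pow Z m `<=` ideal_pow (points_ideal Z) r)
    & q = m%:R / r%:R]].

Definition asymptotic_resurgence (R : realType) (n : nat) (K : fieldType)
    (Z : seq 'rV[K]_n) : R :=
  sup [set q : R | exists m r : nat, [/\ (0 < m)%N, (0 < r)%N,
    exists N : nat, forall s : nat, (N <= s)%N ->
      ~ (symbolic_pow Z (m * s)%N `<=` ideal_pow (points_ideal Z) (r * s)%N)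
    & q = m%:R / r%:R]].

Definition pt (K : fieldType) (a b c : K) : 'rV[K]_3 :=
  \row_j [:: a; b; c]`_j.

(* The points A, B, ..., S, in this order. *)
Definition points19 (K : fieldType) (t : K) : seq 'rV[K]_3 :=
  [:: pt 0 0 1; pt 0 1 0; pt 1 0 0; pt 0 1 1; pt 1 0 1; pt 1 t 0;
      pt 1 t 1; pt 1 (t + 1) 1; pt 1 0 (- t); pt 1 t (t + 1); pt 1 (- 1) 0;
      pt 0 1 (- t); pt 1 0 (t ^+ 2 + t + 1); pt t (t ^+ 2 + t + 1) 0;
      pt t (- (t + 1)) t;
      pt 1 t (- (t ^+ 2 + t)); pt 0 (- 1) (t + 1);
      pt (t + 2%:R) (t ^+ 2 + 2%:R * t + 1) 1; pt (t + 2%:R) (- 1) (t + 1)].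

(* For every t the 19 coordinate vectors are nonzero, hence are points. *)
Lemma points19_neq0 (K : fieldType) (t : K) (v : 'rV[K]_3) :
  v \in points19 t -> v != 0.
Proof.
have ptP a b c : pt a b c = 0 :> 'rV[K]_3 -> [/\ a = 0, b = 0 & c = 0].
  move=> /rowP e.
  move: (e (@Ordinal 3 0 isT)) (e (@Ordinal 3 1 isT)) (e (@Ordinal 3 2 isT)).
  by rewrite !mxE.
have n1 : (1 : K) <> 0 by apply/eqP; rewrite oner_eq0.
have nN1 : (- 1 : K) <> 0 by apply/eqP; rewrite oppr_eq0 oner_eq0.
move=> vZ; apply/eqP => v0; move: vZ; rewrite {}v0 => z0.
move: z0; rewrite !inE.
do 18![case/orP; first by move/eqP/esym/ptP => [] //;
  do ?[move=> ->]; rewrite ?expr0n /= ?add0r ?mulr0 ?addr0 //].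
by move/eqP/esym/ptP => [].
Qed.

(* Main.v *)
Require Import Defs.
From HB Require Import structures.
From mathcomp Require Import all_boot all_order all_algebra.
From mathcomp Require Import boolp classical_sets reals.
From mathcomp Require Import mpoly.
From mathcomp Require Import ring lra zify.

(** Let I be the ideal of the nineteen points and I_p the ideal of a point p.
    Both resurgences are read off from two estimates on degrees.

    - A nonzero form of I^(m) has degree at least 4 m [symbolic_degree], and
      I^(3k) contains a nonzero form of degree 12 k [symbolic_small_degree].
    - A form of I^(r) whose degree is at least 5 r + 4 lies in I^r
      [symbolic_sub_pow].

    Hence I^(m) is contained in I^r as soon as r <= m and 5 r + 4 <= 4 m.  If
    m / r > 3 / 2 then 4 m >= 6 r + 2, which is at least 5 r + 4 when r >= 2,
    while I^(m) is contained in I anyway; so the resurgence is at most 3 / 2,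
    and m = 3, r = 2 attains this value.  In the other direction, I^r starts
    in degree 5 r, so I^(m) is not contained in I^r when 4 m + 12 < 5 r.  In
    the asymptotic resurgence m and r are multiplied by a large s, the
    constants 4 and 12 disappear, and the threshold is m / r = 5 / 4.

    First estimate.  For generic t there are twelve lines through at least
    four of the points and each point lies on three of them, so the product of
    the twelve lines is in I^(3).  The lower bound uses the sixteen points
    other than A, H, K.  The four lines ABDLQ, ACEIM, AFGJP, NORS cut them into
    four quadruples.  If a form vanishes along one quadruple to a total order
    that exceeds its degree, then the line splits off; the total order over
    the sixteen points drops by at most 4 and 4 times the degree drops by 4
    [lines_degree_bound].  For special t the incidences could degenerate: what
    excludes it is that I is generated by quintics, so that no line contains
    six of the points [line_few_points].

    Second estimate.  By regularity 7 the quintics that generate I have their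
    syzygies generated in degree at most 8 [presentation_of_regularity].  From
    this and the exactness of the Koszul complex of the variables, forms of
    degree at least 6 take arbitrary values at the points [interpolates_ge].
    By induction on r, forms of degree at least 5 r + 1 have arbitrary residues
    modulo the ideals I_p^r [fat_interpolation].  Finally, let f in I^(r+1)
    have degree d >= 5 (r + 1) + 4, and write f as a combination of the
    quintics.  Near each p the coefficients can be chosen in I_p^r, and this
    changes them by a combination of basic syzygies.  The coefficients of
    these combinations have degree at least d - 8 >= 5 r + 1, so they are
    interpolated by forms; the corrected coefficients of f are in I^(r), and
    induction applies.  This is an elementary form of the cohomological proof
    that I^r has regularity at most r omega + 2 (reg - omega). *)

Set Implicit Arguments.
Unset Strict Implicit.
Unset Printing Implicit Defensive.
Import Order.TTheory GRing.Theory Num.Theory.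
Local Open Scope classical_set_scope.
Local Open Scope ring_scope.

(** * Ideals, powers and homogeneous components *)

Section Ideals.
Variables (n : nat) (K : fieldType).
Local Notation P := {mpoly K[n]}.
Implicit Types (I J G : set P) (f g : P).

Record is_ideal J : Prop := IsIdeal {
  ideal_zero : J 0;
  ideal_add : forall f g, J f -> J g -> J (f + g);
  ideal_mul : forall c f, J f -> J (c * f) }.

Lemma ideal_mulr J f c : is_ideal J -> J f -> J (f * c).
Proof. by move=> iJ Jf; rewrite mulrC; apply: ideal_mul. Qed.

Lemma ideal_opp J f : is_ideal J -> J f -> J (- f).
Proof. by move=> iJ Jf; rewrite -mulN1r; apply: ideal_mul. Qed.

Lemma ideal_sub J f g : is_ideal J -> J f -> J g -> J (f - g).
Proof. by move=> iJ Jf Jg; apply: ideal_add => //; apply: ideal_opp. Qed.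

Lemma ideal_sum J (A : Type) (r : seq A) (Q : pred A) (F : A -> P) :
  is_ideal J -> (forall i, Q i -> J (F i)) -> J (\sum_(i <- r | Q i) F i).
Proof.
move=> iJ JF; apply: (big_ind J) => //; first exact: ideal_zero.
exact: ideal_add.
Qed.

Lemma ideal_gen_ideal G : is_ideal (ideal_gen G).
Proof.
split.
- exists 0%N, (fun=> 0), (fun=> 0); split; first by case.
  by rewrite big_ord0.
- move=> _ _ [k [c [g [Gg ->]]]] [l [d [h [Gh ->]]]].
  exists (k + l)%N, (fun i => match fintype.split i with inl a => c a | inr b => d b end),
    (fun i => match fintype.split i with inl a => g a | inr b => h b end).
  split; first by move=> i; case: (fintype.split i).
  rewrite big_split_ord /=; congr (_ + _); apply: eq_bigr => i _.
    by rewrite -/(unsplit (inl i)) unsplitK.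
  by rewrite -/(unsplit (inr i)) unsplitK.
- move=> a _ [k [c [g [Gg ->]]]]; exists k, (fun i => a * c i), g; split=> //.
  by rewrite mulr_sumr; apply: eq_bigr => i _; rewrite mulrA.
Qed.

Lemma ideal_gen_in G f : G f -> ideal_gen G f.
Proof.
move=> Gf; exists 1%N, (fun=> 1), (fun=> f); split=> //.
by rewrite big_ord1 mul1r.
Qed.

Lemma ideal_gen_min G J : is_ideal J -> G `<=` J -> ideal_gen G `<=` J.
Proof.
move=> iJ GJ _ [k [c [g [Gg ->]]]]; apply: ideal_sum => // i _.
by apply: ideal_mul => //; apply: GJ.
Qed.

Lemma ideal_pow_ideal I r : is_ideal (ideal_pow I r).
Proof. exact: ideal_gen_ideal. Qed.

Lemma ideal_pow0 I f : ideal_pow I 0 f.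
Proof.
rewrite -[f]mulr1; apply: ideal_mul; first exact: ideal_pow_ideal.
by apply: ideal_gen_in; exists (fun=> 0); split; [case | rewrite big_ord0].
Qed.

Lemma ideal_powM I a b f g :
  ideal_pow I a f -> ideal_pow I b g -> ideal_pow I (a + b) (f * g).
Proof.
move=> [k [c [p [Ip ->]]]] [l [d [q [Iq ->]]]].
rewrite mulr_suml; apply: ideal_sum; first exact: ideal_pow_ideal.
move=> i _; rewrite mulr_sumr; apply: ideal_sum; first exact: ideal_pow_ideal.
move=> j _; rewrite mulrACA; apply: ideal_mul; first exact: ideal_pow_ideal.
have [u [Iu ->]] := Ip i; have [v [Iv ->]] := Iq j.
apply: ideal_gen_in.
exists (fun s => match fintype.split s with inl x => u x | inr y => v y end).
split; first by move=> s; case: (fintype.split s).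
rewrite big_split_ord /=; congr (_ * _); apply: eq_bigr => s _.
  by rewrite -/(unsplit (inl s)) unsplitK.
by rewrite -/(unsplit (inr s)) unsplitK.
Qed.

Lemma ideal_pow1 I f : is_ideal I -> ideal_pow I 1 f <-> I f.
Proof.
move=> iI; split.
  by apply: ideal_gen_min => // _ [g [Ig ->]]; rewrite big_ord1.
by move=> If; apply: ideal_gen_in; exists (fun=> f); rewrite big_ord1.
Qed.

Lemma ideal_powS I r :
  is_ideal I -> ideal_pow I r.+1 =
  ideal_gen [set f | exists a b, [/\ I a, ideal_pow I r b & f = a * b]].
Proof.
move=> iI; apply/seteqP; split; apply: ideal_gen_min;
  do ?exact: ideal_gen_ideal.
  move=> _ [g [Ig ->]]; apply: ideal_gen_in; rewrite big_ord_recl.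
  exists (g ord0), (\prod_(i < r) g (lift ord0 i)); split=> //.
  by apply: ideal_gen_in; exists (fun i => g (lift ord0 i)).
move=> _ [a [b [Ia Ib ->]]]; rewrite -add1n; apply: ideal_powM => //.
exact/ideal_pow1.
Qed.

Lemma ideal_powSr I r f g :
  is_ideal I -> ideal_pow I r f -> I g -> ideal_pow I r.+1 (f * g).
Proof.
move=> iI rf Ig; rewrite -addn1; apply: (ideal_powM rf).
exact/ideal_pow1.
Qed.

Lemma ideal_powW I a b : (a <= b)%N -> ideal_pow I b `<=` ideal_pow I a.
Proof.
move=> le_ab; apply: ideal_gen_min; first exact: ideal_pow_ideal.
move=> _ [g [Ig ->]]; move: g Ig; rewrite -(subnKC le_ab) => g Ig.
rewrite big_split_ord /=; apply: ideal_mulr; first exact: ideal_pow_ideal.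
by apply: ideal_gen_in; exists (fun i => g (lshift _ i)).
Qed.

(** Orders of vanishing, lowest degrees and divisibility by a power of a
    given form all increase with the power of I for this one reason. *)
Lemma ideal_pow_filtration I (J : nat -> set P) :
  (forall m, is_ideal (J m)) -> J 0%N 1 -> I `<=` J 1%N ->
  (forall m f g, J 1%N f -> J m g -> J m.+1 (f * g)) ->
  forall m, ideal_pow I m `<=` J m.
Proof.
move=> iJ J0 IJ JM m; apply: ideal_gen_min; first exact: iJ.
move=> _ [g [Ig ->]]; elim: m g Ig => [|m IH] g Ig.
  by rewrite big_ord0.
rewrite big_ord_recl; apply: JM; first exact: IJ.
exact: (IH (fun i => g (lift ord0 i))).
Qed.

Definition hom_closed J : Prop := forall d f, J f -> J (pihomog mdeg d f).

Definition hom_ideal J : Prop := is_ideal J /\ hom_closed J.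

(** The contribution to degree e of a cofactor of a form of degree k; with the
    value 0 for e < k, [pihomogM_form] needs no condition on the degrees. *)
Definition cofactor_part (e k : nat) f : P :=
  if (k <= e)%N then pihomog mdeg (e - k) f else 0.

Lemma pihomogM_form e k c s : s \is k.-homog ->
  pihomog mdeg e (c * s) = cofactor_part e k c * s.
Proof.
move=> sk; rewrite {1}(@pihomog_partitionE _ _ mdeg (msize c) c (leqnn _)).
rewrite mulr_suml raddf_sum /= /cofactor_part.
have cs i : pihomog mdeg i c * s \is (i + k).-homog.
  by apply: dhomogM => //; apply: pihomogP.
case: leqP => [le_ke|lt_ek].
  rewrite (eq_bigr (fun i : 'I_(msize c) =>
    if i == (e - k)%N :> nat then pihomog mdeg i c * s else 0)); last first.
    move=> i _; case: eqP => [ie|ne].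
      by rewrite pihomog_dE //; move: (cs i); rewrite {2}ie subnK.
    by rewrite (pihomog_ne0 _ (cs i)) //; apply/eqP; lia.
  rewrite -big_mkcond /=.
  case: (ltnP (e - k)%N (msize c)) => [lt|ge].
    by rewrite (big_pred1 (Ordinal lt)).
  rewrite big_pred0; last first.
    by move=> i; apply/negbTE/eqP => ie; have := ltn_ord i; rewrite ie ltnNge ge.
  rewrite pihomogE big_seq_cond big_pred0 ?mul0r // => m.
  apply/negbTE/negP => /andP[/msize_mdeg_lt lt_m /eqP me].
  by move: lt_m; rewrite me ltnNge ge.
rewrite big1 ?mul0r // => i _; rewrite (pihomog_ne0 _ (cs i)) //.
by apply/eqP; lia.
Qed.

Lemma cofactor_partP e k f :
  (k <= e)%N -> cofactor_part e k f \is (e - k).-homog.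
Proof. by move=> le; rewrite /cofactor_part le pihomogP. Qed.

Lemma cofactor_part_lt e k f : (e < k)%N -> cofactor_part e k f = 0.
Proof. by rewrite /cofactor_part ltnNge => /negbTE->. Qed.

Lemma hom_closed_mul J f :
  is_ideal J -> (forall d, J (pihomog mdeg d f)) ->
  forall c d, J (pihomog mdeg d (c * f)).
Proof.
move=> iJ Jf c d.
rewrite {1}(@pihomog_partitionE _ _ mdeg (msize f) f (leqnn _)).
rewrite mulr_sumr raddf_sum; apply: ideal_sum => // i _ /=.
rewrite (@pihomogM_form _ i); last exact: pihomogP.
exact: ideal_mul.
Qed.

Lemma hom_ideal_gen G :
  (forall d f, G f -> ideal_gen G (pihomog mdeg d f)) -> hom_ideal (ideal_gen G).
Proof.
move=> Gd; split; first exact: ideal_gen_ideal.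
move=> d _ [k [c [g [Gg ->]]]]; rewrite raddf_sum; apply: ideal_sum => /=.
  exact: ideal_gen_ideal.
move=> i _; apply: hom_closed_mul => [|e]; first exact: ideal_gen_ideal.
exact: Gd.
Qed.

Lemma hom_ideal_gen_forms G :
  (forall f, G f -> exists d, f \is d.-homog) -> hom_ideal (ideal_gen G).
Proof.
move=> Gh; apply: hom_ideal_gen => d f Gf; have [e fe] := Gh _ Gf.
have [<-|ne] := eqVneq e d; first by rewrite pihomog_dE //; apply: ideal_gen_in.
rewrite (pihomog_ne0 ne) //; apply: ideal_zero; exact: ideal_gen_ideal.
Qed.

Lemma hom_ideal_pow I r : hom_ideal I -> hom_ideal (ideal_pow I r).
Proof.
move=> [iI hI]; elim: r => [|r [iJ hJ]].
  by split; [exact: ideal_pow_ideal | move=> d f _; exact: ideal_pow0].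
rewrite ideal_powS //; apply: hom_ideal_gen => d _ [a [b [Ia Jb ->]]].
rewrite mulrC (@pihomog_partitionE _ _ mdeg (msize a) a (leqnn _)).
rewrite mulr_sumr raddf_sum; apply: ideal_sum => [|i _] /=.
  exact: ideal_gen_ideal.
rewrite (@pihomogM_form _ i); last exact: pihomogP.
apply: ideal_gen_in; exists (pihomog mdeg i a), (cofactor_part d i b).
split; [exact: hI | | exact: mulrC].
by rewrite /cofactor_part; case: ifP => _; [exact: hJ | apply: ideal_zero; exact: ideal_pow_ideal].
Qed.
End Ideals.

(** * Substitutions, linear forms and lowest degrees *)

Section Substitutions.
Variables (n : nat) (K : fieldType).
Local Notation P := {mpoly K[n]}.

Lemma mpoly_subring_ind (Q : P -> Prop) :
  (forall c, Q c%:MP) -> (forall i, Q 'X_i) ->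
  (forall f g, Q f -> Q g -> Q (f + g)) ->
  (forall f g, Q f -> Q g -> Q (f * g)) -> forall f, Q f.
Proof.
move=> QC QX QD QM f; rewrite (mpolyE f).
apply: big_ind => [||m _]; [by rewrite -mpolyC0 | exact: QD |].
rewrite -mul_mpolyC mpolyXE_id; apply: (QM) => //.
apply: big_ind => [||i _]; [by rewrite -mpolyC1 | exact: QM |].
by elim: (m i) => [|k IH]; rewrite ?expr0 -?mpolyC1 // exprS; apply: (QM).
Qed.

Lemma mpoly_morphism_ext (S : nzRingType) (u w : {rmorphism P -> S}) :
  (forall c, u c%:MP = w c%:MP) -> (forall i, u 'X_i = w 'X_i) -> u =1 w.
Proof.
move=> uwC uwX; apply: mpoly_subring_ind => // f g uf ug.
  by rewrite !rmorphD uf ug.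
by rewrite !rmorphM uf ug.
Qed.

Lemma mmap_homog (S : comNzRingType) (h : {rmorphism K -> S}) (c : S)
    (u : 'I_n -> S) (d : nat) (f : P) : f \is d.-homog ->
  mmap h (fun i => c * u i) f = c ^+ d * mmap h u f.
Proof.
move/dhomogP => fd; rewrite /mmap mulr_sumr; apply: eq_big_seq => m mf.
rewrite mulrCA; congr (_ * _); rewrite /mmap1 -(fd m mf) /= mdegE.
under eq_bigr do rewrite exprMn.
by rewrite big_split /= prodrXr.
Qed.

Lemma mmap_mpolyC_eval (u : 'I_n -> K) (f : P) :
  mmap (@mpolyC n K) (fun i => (u i)%:MP) f = (f.@[u])%:MP.
Proof.
apply: (@mpoly_morphism_ext _ (mmap (@mpolyC n K) (fun i => (u i)%:MP))
  (@mpolyC n K \o meval u)) => [c|i] /=.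
  by rewrite mmapC mevalC.
by rewrite mmapX mmap1U mevalXU.
Qed.

Definition linform (c : 'cV[K]_n) : P := \sum_i c i 0 *: 'X_i.

Lemma linform_homog c : linform c \is 1.-homog.
Proof.
by apply: rpred_sum => i _; apply: rpredZ; rewrite dhomogX /= mdeg1.
Qed.

Lemma linform_eval c (v : 'rV[K]_n) : (linform c).@[v 0] = (v *m c) 0 0.
Proof.
rewrite /linform rmorph_sum mxE; apply: eq_bigr => i _ /=.
by rewrite mevalZ mevalXU mulrC.
Qed.

Lemma linform_eq0 c : (linform c == 0) = (c == 0).
Proof.
apply/eqP/eqP => [l0|->]; last first.
  by rewrite /linform big1 // => i _; rewrite mxE scale0r.
apply/colP => i; rewrite mxE -(mulr1 (c i 0)).
have := linform_eval c (delta_mx 0 i); rewrite l0 meval0 -rowE mxE mulr1 => <-.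
by [].
Qed.

Lemma eval_neq0 (f : P) (v : 'rV[K]_n) : f.@[v 0] != 0 -> f != 0.
Proof. by apply: contraNneq => ->; rewrite meval0. Qed.

Lemma nonzero_linform (v : 'rV[K]_n) : v != 0 -> exists c : 'cV[K]_n, (v *m c) 0 0 = 1.
Proof.
move=> v0; have [i vi] : exists i, v 0 i != 0.
  apply/existsP; apply: contraR v0 => /existsPn v0.
  by apply/eqP/rowP => i; rewrite mxE; apply/eqP; rewrite -[_ == _]negbK.
exists ((v 0 i)^-1 *: delta_mx i (0 : 'I_1)).
by rewrite -scalemxAr -colE !mxE mulVf.
Qed.
End Substitutions.

Section LowDegree.
Variables (n : nat) (K : fieldType).
Local Notation P := {mpoly K[n]}.

Definition degree_ge (N : nat) : set P :=
  [set f | forall d, (d < N)%N -> pihomog mdeg d f = 0].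

Lemma degree_geM A B : forall a b, degree_ge A a -> degree_ge B b ->
  degree_ge (A + B) (a * b).
Proof.
move=> a b Aa Bb d lt_d.
rewrite (@pihomog_partitionE _ _ mdeg (msize b) b (leqnn _)).
rewrite mulr_sumr raddf_sum big1 // => i _ /=.
case: (ltnP i B) => [/Bb->|le_Bi]; first by rewrite mulr0 pihomog0.
rewrite (@pihomogM_form _ _ _ i); last exact: pihomogP.
rewrite /cofactor_part; case: leqP => [le_id|_]; last by rewrite mul0r.
by rewrite Aa ?mul0r //; lia.
Qed.

Lemma degree_ge_ideal N : is_ideal (degree_ge N).
Proof.
split.
- by move=> d _; rewrite pihomog0.
- by move=> f g Nf Ng d lt_d; rewrite pihomogD Nf // Ng // addr0.
- by move=> c f Nf; rewrite -(add0n N); apply: degree_geM.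
Qed.

Lemma degree_ge_pow (I : set P) N r : I `<=` degree_ge N ->
  ideal_pow I r `<=` degree_ge (N * r).
Proof.
move=> IN; apply: (@ideal_pow_filtration _ _ _ (fun r => degree_ge (N * r))).
- by move=> m; apply: degree_ge_ideal.
- by rewrite muln0.
- by rewrite muln1.
- by move=> m f g; rewrite muln1 mulnS; apply: degree_geM.
Qed.

Lemma degree_ge_form N d f : degree_ge N f -> f \is d.-homog -> f != 0 ->
  (N <= d)%N.
Proof.
move=> Nf fd; apply: contraR; rewrite -ltnNge => lt_d.
by rewrite -(pihomog_dE fd) Nf.
Qed.
End LowDegree.

(** * Powers of the ideal of a point as orders of vanishing *)

Lemma affine_coef (R : nzRingType) (a b : R) k :
  (a%:P + 'X * b%:P)`_k = if k is k'.+1 then if k' is 0 then b else 0 else a.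
Proof.
by rewrite coefD coefXM !coefC; case: k => [|[|k]] /=; rewrite ?addr0 ?add0r.
Qed.

Lemma affine_horner (R : nzRingType) (a b t : R) :
  (a%:P + 'X * b%:P).[t] = a + b * t.
Proof. by rewrite -commr_polyX hornerD hornerMX !hornerC. Qed.

Lemma map_affine_horner (R S : nzRingType) (u : {rmorphism R -> S}) (a b : R)
    (t : S) :
  (map_poly u (a%:P + 'X * b%:P)).[t] = u a + u b * t.
Proof. by rewrite rmorphD rmorphM /= !map_polyC map_polyX affine_horner. Qed.

Lemma homog0C (n : nat) (K : fieldType) (f : {mpoly K[n]}) :
  f \is 0.-homog -> f = (f@_0%MM)%:MP.
Proof.
move=> f0; apply/mpolyP => m; rewrite mcoeffC.
have [->|m0] := eqVneq m 0%MM; first by rewrite mulr1.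
by rewrite mulr0 (dhomog_nemf_coeff f0) //= mdeg_eq0.
Qed.

Section PolyOrder.
Variable R : idomainType.

Definition order_ge (m : nat) (A : {poly R}) : Prop :=
  forall k, (k < m)%N -> A`_k = 0.

Lemma order_ge0 m : order_ge m 0.
Proof. by move=> k _; rewrite coef0. Qed.

Lemma order_geD m (A B : {poly R}) :
  order_ge m A -> order_ge m B -> order_ge m (A + B).
Proof. by move=> Am Bm k lt_k; rewrite coefD Am // Bm // addr0. Qed.

Lemma order_geM a b (A B : {poly R}) : order_ge a A -> order_ge b B -> order_ge (a + b) (A * B).
Proof.
move=> Aa Bb k lt_k; rewrite coefM big1 // => i _.
case: (ltnP i a) => [/Aa->|le_ai]; first by rewrite mul0r.
by rewrite Bb ?mulr0 //; have := ltn_ord i; lia.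
Qed.

Lemma order_ge_cancel m (A B : {poly R}) : A`_0 != 0 -> order_ge m (A * B) -> order_ge m B.
Proof.
move=> A0 ABm k; elim/ltn_ind: k => k IH lt_km.
have := ABm k lt_km; rewrite coefM big_ord_recl /= subn0 big1 ?addr0.
  by move/eqP; rewrite mulf_eq0 (negbTE A0) => /eqP.
move=> i _; rewrite IH ?mulr0 //= /bump /=; first by have := ltn_ord i; lia.
by have := ltn_ord i; lia.
Qed.

End PolyOrder.

Section OrderOfVanishing.
Variables (n : nat) (K : fieldType).
Local Notation P := {mpoly K[n]}.
Implicit Types (v : 'rV[K]_n) (Z : seq 'rV[K]_n).

Lemma points_ideal_hom Z : hom_ideal (points_ideal Z).
Proof. by apply: hom_ideal_gen_forms => f []. Qed.

Lemma points_ideal_ideal Z : is_ideal (points_ideal Z).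
Proof. by have [] := points_ideal_hom Z. Qed.

Lemma points_ideal_eval Z f v : points_ideal Z f -> v \in Z -> f.@[v 0] = 0.
Proof.
move=> Zf vZ; move: f Zf; apply: ideal_gen_min => [|f [_]]; last exact.
split=> [|f g|c f]; first by rewrite /= meval0.
  by rewrite /= mevalD => -> ->; rewrite addr0.
by rewrite /= mevalM => ->; rewrite mulr0.
Qed.

Lemma points_ideal_form Z d f : f \is d.-homog ->
  (forall v, v \in Z -> f.@[v 0] = 0) -> points_ideal Z f.
Proof. by move=> fd fZ; apply: ideal_gen_in; split=> //; exists d. Qed.

Lemma points_ideal_sub Z v : v \in Z -> points_ideal Z `<=` points_ideal [:: v].
Proof.
move=> vZ; apply: ideal_gen_min; first exact: points_ideal_ideal.
move=> f [[d fd] f0]; apply: (points_ideal_form fd) => w.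
by rewrite inE => /eqP->; apply: f0.
Qed.

Lemma point_form_mem v d f : f \is d.-homog -> f.@[v 0] = 0 ->
  points_ideal [:: v] f.
Proof. by move=> fd f0; apply: (points_ideal_form fd) => w; rewrite inE => /eqP->. Qed.

Lemma symbolic_pow_hom Z m : hom_ideal (symbolic_pow Z m).
Proof.
have h v : hom_ideal (ideal_pow (points_ideal [:: v]) m).
  by apply: hom_ideal_pow; apply: points_ideal_hom.
split; first split.
- by move=> v _; apply: ideal_zero; apply: ideal_pow_ideal.
- move=> f g Sf Sg v vZ; apply: ideal_add; first exact: ideal_pow_ideal.
    exact: Sf.
  exact: Sg.
- move=> c f Sf v vZ; apply: ideal_mul; first exact: ideal_pow_ideal.
  exact: Sf.
- by move=> d f Sf v vZ; have [_] := h v; apply; apply: Sf.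
Qed.

Section Jet.
Variables (v : 'rV[K]_n) (l : 'cV[K]_n).
Let lam : P := linform l.

Let jet_var i : {poly P} :=
  (lam * (v 0 i)%:MP)%:P + 'X * ('X_i - lam * (v 0 i)%:MP)%:P.

(** When l(v) = 1, the substitution x -> l(x) v + T (x - l(x) v) is the dilation
    centred at v of the coordinates x - l(x) v.  The power of T that divides
    the image of f is the order of vanishing of f at v. *)
Definition jet : P -> {poly P} := mmap (polyC \o @mpolyC n K) jet_var.

HB.instance Definition _ := GRing.RMorphism.on jet.

Lemma jetD f g : jet (f + g) = jet f + jet g.
Proof. exact: rmorphD. Qed.

Lemma jetM f g : jet (f * g) = jet f * jet g.
Proof. exact: rmorphM. Qed.

Lemma jet0 : jet 0 = 0.
Proof. exact: rmorph0. Qed.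

Lemma jetC c : jet c%:MP = c%:MP%:P.
Proof. by rewrite /jet mmapC. Qed.

Lemma jetX i : jet 'X_i = jet_var i.
Proof. by rewrite /jet mmapX mmap1U. Qed.

(** For T = 0 the substitution sends x to the multiple l(x) v of v. *)
Lemma jet_coef0 d f : f \is d.-homog -> (jet f)`_0 = lam ^+ d * (f.@[v 0])%:MP.
Proof.
move=> fd.
have -> : (jet f)`_0 = mmap (@mpolyC n K) (fun i => lam * (v 0 i)%:MP) f.
  apply: (@mpoly_morphism_ext _ _ _ (coefp 0 \o jet)
    (mmap (@mpolyC n K) (fun i => lam * (v 0 i)%:MP))) => [c|i] /=.
    by rewrite jetC mmapC [c%:MP%:P`_0]coefC.
  by rewrite jetX affine_coef mmapX mmap1U.
by rewrite (mmap_homog _ _ _ fd) mmap_mpolyC_eval.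
Qed.

Lemma jet_linform c : jet (linform c) =
  (lam * ((v *m c) 0 0)%:MP)%:P + 'X * (linform c - lam * ((v *m c) 0 0)%:MP)%:P.
Proof.
have -> : (v *m c) 0 0 = \sum_i c i 0 * v 0 i.
  by rewrite mxE; apply: eq_bigr => i _; rewrite mulrC.
rewrite {1 2}/linform rmorph_sum /=.
rewrite (eq_bigr (fun i => (lam * (c i 0 * v 0 i)%:MP)%:P +
   'X * (c i 0 *: 'X_i - lam * (c i 0 * v 0 i)%:MP)%:P)); last first.
  move=> i _; rewrite -mul_mpolyC jetM jetC jetX /jet_var.
  by rewrite !(rmorphM, rmorphD, rmorphN) /=; ring.
rewrite big_split /= -mulr_sumr -!rmorph_sum /= sumrB -!mulr_sumr.
by rewrite -!rmorph_sum.
Qed.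

Hypothesis lv : (v *m l) 0 0 = 1.

Lemma jet_horner1 f : (jet f).[1] = f.
Proof.
apply: (@mpoly_morphism_ext _ _ _ (horner_eval 1 \o jet) idfun) => [c|i] /=.
  by rewrite jetC /horner_eval hornerC.
by rewrite jetX /horner_eval affine_horner mulr1 addrC subrK.
Qed.

(** Each factor T comes with a linear form x_i - l(x) v_i, which vanishes at v. *)
Lemma jet_coef_pow f : forall k, ideal_pow (points_ideal [:: v]) k (jet f)`_k.
Proof.
have I0 k : ideal_pow (points_ideal [:: v]) k 0.
  by apply: ideal_zero; apply: ideal_pow_ideal.
move: f; apply: mpoly_subring_ind => [c|i|f g Qf Qg|f g Qf Qg] k.
- by rewrite jetC coefC; case: k => [|k]; [exact: ideal_pow0 | exact: I0].
- rewrite jetX affine_coef; case: k => [|[|k]].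
  + exact: ideal_pow0.
  + apply/ideal_pow1; first exact: points_ideal_ideal.
    apply: (@point_form_mem _ 1).
      apply: rpredB; first by rewrite dhomogX /= mdeg1.
      rewrite mulrC mul_mpolyC; apply: rpredZ; exact: linform_homog.
    by rewrite mevalB mevalM mevalXU mevalC linform_eval lv mul1r subrr.
  + exact: I0.
- rewrite jetD coefD.
  by apply: ideal_add; [exact: ideal_pow_ideal | exact: Qf | exact: Qg].
- rewrite jetM coefM; apply: ideal_sum => [|i _]; first exact: ideal_pow_ideal.
  rewrite -{1}(@subnKC i k) ?leq_ord //.
  by apply: ideal_powM; [exact: Qf | exact: Qg].
Qed.

(** Setting T = 1 writes f as the sum of the coefficients of its jet, the k-th of
    which lies in I_v^k; if those with k < m are zero then f is in I_v^m. *)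
Lemma point_powP m f :
  ideal_pow (points_ideal [:: v]) m f <-> order_ge m (jet f).
Proof.
split; last first.
  move=> fm; rewrite -(jet_horner1 f) horner_coef.
  apply: ideal_sum => [|i _]; first exact: ideal_pow_ideal.
  rewrite expr1n mulr1; case: (ltnP i m) => [/fm->|le_mi].
    by apply: ideal_zero; apply: ideal_pow_ideal.
  by apply: (ideal_powW le_mi); apply: jet_coef_pow.
have ideal_ord k : is_ideal [set g | order_ge k (jet g)].
  split=> [|g h gk hk|c g gk] /=.
  - by rewrite jet0; apply: order_ge0.
  - rewrite jetD; exact: (order_geD gk hk).
  - rewrite jetM -(add0n k); apply: (order_geM _ gk) => j; exact.
have ord1 : points_ideal [:: v] `<=` [set g | order_ge 1 (jet g)].
  apply: ideal_gen_min => // g [[d gd] g0] [|//] _.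
  by rewrite (jet_coef0 gd) g0 ?inE // mpolyC0 mulr0.
have := @ideal_pow_filtration _ _ _ (fun k => [set g | order_ge k (jet g)])
  ideal_ord _ ord1 _ m f; apply=> //.
by move=> k g h g1 hk /=; rewrite jetM; apply: (order_geM g1 hk).
Qed.
End Jet.

(** I_v^m is primary: a form that does not vanish at v is not a zero divisor
    modulo I_v^m. *)
Lemma point_pow_cancel v m e w f : v != 0 -> w \is e.-homog -> w.@[v 0] != 0 ->
  ideal_pow (points_ideal [:: v]) m (w * f) ->
  ideal_pow (points_ideal [:: v]) m f.
Proof.
move=> v0 we wv; have [l lv] := nonzero_linform v0.
move/(point_powP lv); rewrite jetM => wfm; apply/(point_powP lv).
apply: order_ge_cancel wfm; rewrite (jet_coef0 _ _ we) mulf_neq0 //.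
  rewrite expf_neq0 //; apply: (@eval_neq0 _ _ _ v).
  by rewrite linform_eval lv oner_eq0.
by rewrite mpolyC_eq0.
Qed.

(** A nonzero linear form that vanishes at v does so to order exactly one. *)
Lemma point_pow_cancel_linform v m (c : 'cV[K]_n) f : v != 0 -> c != 0 -> v *m c = 0 ->
  ideal_pow (points_ideal [:: v]) m (linform c * f) ->
  ideal_pow (points_ideal [:: v]) m.-1 f.
Proof.
move=> v0 c0 vc; have [l lv] := nonzero_linform v0.
move/(point_powP lv); rewrite jetM jet_linform vc mxE.
rewrite mpolyC0 mulr0 subr0 rmorph0 add0r => h; apply/(point_powP lv).
move=> k lt_k; have := h k.+1; rewrite -mulrA coefXM coefCM /=.
have lt_Sk : (k.+1 < m)%N by lia.
by move/(_ lt_Sk)/eqP; rewrite mulf_eq0 linform_eq0 (negbTE c0) => /eqP.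
Qed.

Lemma point_ideal_degree_ge v : v != 0 -> points_ideal [:: v] `<=` degree_ge 1.
Proof.
move=> v0 f vf [|//] _; have [_ /(_ 0%N _ vf) h] := points_ideal_hom [:: v].
have := points_ideal_eval h (mem_head _ _).
by rewrite (homog0C (pihomogP mdeg 0 f)) mevalC => ->; rewrite mpolyC0.
Qed.
End OrderOfVanishing.

(** * Isolating a point, and the Koszul relations of the variables *)

Section Separation.
Variables (n : nat) (K : fieldType).
Local Notation P := {mpoly K[n]}.
Implicit Types (v w : 'rV[K]_n) (Z : seq 'rV[K]_n).

Definition projective_points Z : Prop :=
  distinct_points Z /\ forall v, v \in Z -> v != 0.

Lemma projective_points_uniq Z : projective_points Z -> uniq Z.
Proof. by case=> /map_uniq. Qed.

Lemma points_not_proportional Z v w : projective_points Z ->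
  v \in Z -> w \in Z -> v != w -> ~~ (v <= w)%MS.
Proof.
move=> [dZ nZ] vZ wZ; apply: contra => le_vw; apply/eqP.
have eq_vw : <<v>>%MS = <<w>>%MS.
  apply/genmxP.
  have [_ <-] := mxrank_leqif_eq le_vw.
  by rewrite !rank_rV !nZ.
have inj : {in Z &, injective (fun v => <<v>>%MS)}.
  move=> x y xZ yZ eq_xy.
  rewrite -(nth_index 0 xZ) -(nth_index 0 yZ); congr (nth _ _ _).
  apply/eqP; rewrite -(nth_uniq <<0 : 'rV[K]_n>>%MS _ _ dZ) ?size_map ?index_mem //.
  by rewrite !(nth_map 0) ?index_mem // !nth_index // eq_xy.
exact: inj.
Qed.

Lemma separating_form v w : ~~ (v <= w)%MS ->
  exists c : 'cV[K]_n, (v *m c) 0 0 != 0 /\ w *m c = 0.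
Proof.
rewrite submxE => nz; have [j vj] : exists j, (v *m cokermx w) 0 j != 0.
  apply/existsP; apply: contraR nz => /existsPn v0.
  by apply/eqP/rowP => i; rewrite [RHS]mxE; apply/eqP; rewrite -[_ == _]negbK.
exists (col j (cokermx w)); rewrite colE; split.
  by rewrite (mulmxA v (cokermx w)) -colE mxE.
by rewrite (mulmxA w (cokermx w)) mulmx_coker mul0mx.
Qed.

Lemma isolating_form Z p : projective_points Z -> p \in Z ->
  exists d (u : P), [/\ (d <= size Z)%N, u \is d.-homog, u.@[p 0] != 0
    & forall q, q \in Z -> q != p -> u.@[q 0] = 0].
Proof.
move=> ppZ pZ.
have sep (q : 'rV[K]_n) : exists c : 'cV[K]_n,
    (q \in Z) && (q != p) -> (p *m c) 0 0 != 0 /\ q *m c = 0.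
  have [/andP[qZ qp]|_] := boolP ((q \in Z) && (q != p)); last by exists 0.
  have [|c cP] := @separating_form p q; last by exists c.
  by apply: (points_not_proportional ppZ) => //; rewrite eq_sym.
have [c cP] := choice sep.
pose S := [seq q <- Z | q != p].
exists (size S), (\prod_(q <- S) linform (c q)); split.
- by rewrite size_filter; apply: count_size.
- elim: S => [|q S IH]; first by rewrite big_nil dhomog1.
  by rewrite big_cons; apply: (dhomogM (linform_homog _) IH).
- rewrite rmorph_prod /= prodf_seq_neq0; apply/allP => q.
  by rewrite mem_filter andbC /= linform_eval => /cP[].
- move=> q qZ qp; rewrite rmorph_prod /=.
  rewrite (big_rem q) /=; last by rewrite mem_filter qp.
  have [|_ qc] := cP q; first by rewrite qZ.
  by rewrite linform_eval qc mxE mul0r.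
Qed.

(** Near p the ideals of Z and of p agree: a form u that vanishes on Z outside p
    multiplies I_p into I_Z. *)
Lemma isolate_in_ideal Z p d e (u f : P) : u \is d.-homog ->
  (forall q, q \in Z -> q != p -> u.@[q 0] = 0) -> f \is e.-homog ->
  f.@[p 0] = 0 -> points_ideal Z (u * f).
Proof.
move=> ud uq fe fp; apply: (points_ideal_form (dhomogM ud fe)) => q qZ.
have [->|qp] := eqVneq q p; first by rewrite mevalM fp mulr0.
by rewrite mevalM (uq q) // mul0r.
Qed.

Definition interpolates Z (e : nat) : Prop :=
  forall phi : 'rV[K]_n -> K, exists f : P,
    f \is e.-homog /\ forall v, v \in Z -> f.@[v 0] = phi v.

(** Lagrange interpolation with isolating forms. *)
Lemma interpolates_large Z e : projective_points Z -> (size Z <= e)%N ->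
  interpolates Z e.
Proof.
move=> ppZ le_Ze phi.
have iso (p : 'rV[K]_n) : exists u : P, p \in Z ->
    [/\ u \is e.-homog, u.@[p 0] = 1
      & forall q, q \in Z -> q != p -> u.@[q 0] = 0].
  have [pZ|] := boolP (p \in Z); last by exists 0.
  have [d [u [le_d ud up uq]]] := isolating_form ppZ pZ.
  have [c pc] := nonzero_linform (ppZ.2 _ pZ).
  exists ((u.@[p 0])^-1 *: (u * linform c ^+ (e - d))) => _; split.
  - apply: rpredZ.
    have := dhomogM ud (dhomogMn (e - d) (linform_homog c)).
    by rewrite mul1n subnKC // (leq_trans le_d).
  - by rewrite mevalZ mevalM rmorphXn /= linform_eval pc expr1n mulr1 mulVf.
  - by move=> q qZ qp; rewrite mevalZ mevalM (uq q) // mul0r mulr0.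
have [u uP] := choice iso.
exists (\sum_(p <- Z) phi p *: u p); split.
  rewrite big_seq; apply: rpred_sum => p pZ; apply: rpredZ.
  by have [] := uP p pZ.
move=> v vZ; rewrite rmorph_sum /= (bigD1_seq v) ?projective_points_uniq //=.
have [_ uv _] := uP v vZ; rewrite mevalZ uv mulr1 big_seq_cond big1 ?addr0 //.
move=> p /andP[pZ pv]; have [_ _ u0] := uP p pZ.
by rewrite mevalZ u0 ?mulr0 // eq_sym.
Qed.
End Separation.

Section Koszul.
Variables (n : nat) (K : fieldType).
Local Notation P := {mpoly K[n]}.
Implicit Types (f g : P) (i j k : 'I_n).

Definition kill i : P -> P :=
  mmap (@mpolyC n K) (fun j => if j == i then 0 else 'X_j).

HB.instance Definition _ i := GRing.RMorphism.on (kill i).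

Lemma killC i c : kill i c%:MP = c%:MP.
Proof. by rewrite /kill mmapC. Qed.

Lemma killX i j : kill i 'X_j = if j == i then 0 else 'X_j.
Proof. by rewrite /kill mmapX mmap1U. Qed.

Lemma killM i f g : kill i (f * g) = kill i f * kill i g.
Proof. exact: rmorphM. Qed.

Lemma killD i f g : kill i (f + g) = kill i f + kill i g.
Proof. exact: rmorphD. Qed.

Lemma kill0 i : kill i 0 = 0.
Proof. exact: rmorph0. Qed.

Lemma killP i f : exists q, f = 'X_i * q + kill i f.
Proof.
move: f; apply: mpoly_subring_ind => [c|j|f g [p fp] [q gq]|f g [p fp] [q gq]].
- by exists 0; rewrite killC mulr0 add0r.
- rewrite killX; case: eqP => [->|_]; first by exists 1; rewrite mulr1 addr0.
  by exists 0; rewrite mulr0 add0r.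
- exists (p + q); rewrite killD mulrDr {1}fp {1}gq.
  by rewrite addrACA.
- exists (p * g + kill i f * q); rewrite killM.
  rewrite {1}fp mulrDl mulrDr mulrA -addrA; congr (_ + _).
  by rewrite {1}gq mulrDr mulrCA.
Qed.

Lemma kill_eq0 i f : kill i f = 0 -> exists q, f = 'X_i * q.
Proof. by move=> f0; have [q] := killP i f; rewrite f0 addr0; exists q. Qed.

Lemma mpolyX_neq0 i : 'X_i != 0 :> P.
Proof.
apply/eqP => X0; have := mcoeffXU K i i; rewrite X0 mcoeff0 eqxx => /eqP.
by rewrite eq_sym oner_eq0.
Qed.

Lemma koszul2 i j f g : i != j -> 'X_i * f + 'X_j * g = 0 ->
  exists q, f = - ('X_j * q) /\ g = 'X_i * q.
Proof.
move=> ij fg0; have : kill j ('X_i * f + 'X_j * g) = 0 by rewrite fg0 kill0.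
rewrite killD !killM !killX eqxx (negbTE ij) mul0r addr0.
move/eqP; rewrite mulf_eq0 (negbTE (mpolyX_neq0 i)) => /eqP /kill_eq0[q fq].
exists (- q); split; first by rewrite fq mulrN opprK.
apply: (mulfI (mpolyX_neq0 j)); move: fg0; rewrite fq => h.
by apply/eqP; rewrite -subr_eq0 -h; apply/eqP; ring.
Qed.

(** Setting x_j = x_k = 0 shows that f lies in (x_j, x_k); substituting this
    leaves a relation between x_j and x_k alone. *)
Lemma koszul3 i j k f g h : i != j -> i != k -> j != k ->
  'X_i * f + 'X_j * g + 'X_k * h = 0 ->
  exists p q r, [/\ f = 'X_j * p - 'X_k * q, g = 'X_k * r - 'X_i * p
    & h = 'X_i * q - 'X_j * r].
Proof.
move=> ij ik jk s0.
have : kill k (kill j ('X_i * f + 'X_j * g + 'X_k * h)) = 0.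
  by rewrite s0 !kill0.
rewrite !(killD, killM, killX) !eqxx (negbTE ij) (eq_sym k j) (negbTE jk).
rewrite !killX eqxx (negbTE ik) kill0 !mul0r !addr0.
move/eqP; rewrite mulf_eq0 (negbTE (mpolyX_neq0 i)) => /eqP /kill_eq0[q' fq].
have [p fp] := killP j f; rewrite fq in fp.
have [|r [gr hr]] := @koszul2 j k (g + 'X_i * p) (h + 'X_i * q') jk.
  by rewrite -s0 fp; ring.
exists p, (- q'), (- r); split; [rewrite fp | rewrite -[g](addrK ('X_i * p)) gr
  | rewrite -[h](addrK ('X_i * q')) hr]; ring.
Qed.
End Koszul.

Lemma homog_eval_scale (n : nat) (K : fieldType) (f : {mpoly K[n]}) d
    (c : K) (u : 'I_n -> K) : f \is d.-homog ->
  f.@[fun i => c * u i] = c ^+ d * f.@[u].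
Proof. by move=> fd; apply: (mmap_homog _ _ _ fd). Qed.

Section ThreeVariables.
Variable K : fieldType.
Local Notation P := {mpoly K[3]}.

Definition x0 : P := 'X_(@Ordinal 3 0 isT).
Definition x1 : P := 'X_(@Ordinal 3 1 isT).
Definition x2 : P := 'X_(@Ordinal 3 2 isT).

Lemma homog_pos_decomp d (f : P) : (0 < d)%N -> f \is d.-homog ->
  exists p q r, f = x0 * p + x1 * q + x2 * r.
Proof.
move=> d0 fd.
have [p fp] := killP (@Ordinal 3 0 isT) f.
have [q fq] := killP (@Ordinal 3 1 isT) (kill (@Ordinal 3 0 isT) f).
have [r fr] := killP (@Ordinal 3 2 isT)
  (kill (@Ordinal 3 1 isT) (kill (@Ordinal 3 0 isT) f)).
exists p, q, r; rewrite {1}fp fq {}fr /x0 /x1 /x2 -!addrA; congr (_ + _).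
congr (_ + _); rewrite -[RHS]addr0; congr (_ + _).
pose km : {rmorphism P -> P} := kill (@Ordinal 3 2 isT) \o
  (kill (@Ordinal 3 1 isT) \o kill (@Ordinal 3 0 isT)).
pose ev : {rmorphism P -> P} := @mpolyC 3 K \o meval (fun=> 0).
have -> : kill (@Ordinal 3 2 isT) (kill (@Ordinal 3 1 isT)
    (kill (@Ordinal 3 0 isT) f)) = (f.@[fun=> 0])%:MP.
  apply: (@mpoly_morphism_ext _ _ _ km ev) => [c|i] /=.
    by rewrite !killC mevalC.
  rewrite mevalXU killX; case: i => [[|[|[|//]]] ilt] /=.
  - by rewrite !kill0.
  - by rewrite killX /= kill0.
  - by rewrite !killX.
have -> : f.@[fun=> 0] = f.@[fun i : 'I_3 => 0 * (0 : K)].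
  by apply: meval_eq => i; rewrite mul0r.
by rewrite (@homog_eval_scale _ _ _ d 0 (fun=> 0)) // expr0n eqn0Ngt d0 mul0r.
Qed.
End ThreeVariables.

(** * Values of forms on a set of points of the plane *)

Section Presentation.
Variables (n : nat) (K : fieldType).
Local Notation P := {mpoly K[n]}.
Implicit Types (Z : seq 'rV[K]_n).

(** The ideal of Z is generated by forms of one degree dg, and the syzygies of
    these by rows of forms of degree at most ds, so in degree at most dg + ds. *)
Record presentation Z (dg ds : nat) := Presentation {
  ngen : nat;
  nsyz : nat;
  gen : 'I_ngen -> P;
  syz : 'I_nsyz -> 'I_ngen -> P;
  sdeg : 'I_nsyz -> nat;
  gen_homog : forall i, gen i \is dg.-homog;
  genP : forall f, points_ideal Z f <-> exists u, f = \sum_i u i * gen i;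
  syz_homog : forall j i, syz j i \is (sdeg j).-homog;
  sdeg_le : forall j, (sdeg j <= ds)%N;
  syzP : forall u, \sum_i u i * gen i = 0 <->
    exists c, forall i, u i = \sum_j c j * syz j i }.

Variables (Z : seq 'rV[K]_n) (dg ds : nat) (F : presentation Z dg ds).
Local Notation g := (gen (p := F)).
Local Notation s := (syz (p := F)).

Lemma gen_in i : points_ideal Z (g i).
Proof.
apply/(genP F); exists (fun j => if j == i then 1 else 0).
rewrite (bigD1 i) //= eqxx mul1r big1 ?addr0 // => j /negbTE->.
by rewrite mul0r.
Qed.

Lemma lincomb_gen_in (u : 'I_(ngen F) -> P) : points_ideal Z (\sum_i u i * g i).
Proof. by apply/(genP F); exists u. Qed.

Lemma syz_rel j : \sum_i s j i * g i = 0.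
Proof.
apply/(syzP (p := F)); exists (fun k => if k == j then 1 else 0) => i.
rewrite (bigD1 j) //= eqxx mul1r big1 ?addr0 // => k /negbTE->.
by rewrite mul0r.
Qed.

Lemma form_genP d f : (dg <= d)%N -> f \is d.-homog -> points_ideal Z f ->
  exists u, (forall i, u i \is (d - dg).-homog) /\ f = \sum_i u i * g i.
Proof.
move=> le_ad fd /(genP F)[u fu]; exists (fun i => cofactor_part d dg (u i)).
split; first by move=> i; apply: cofactor_partP.
rewrite -[LHS](pihomog_dE fd) fu raddf_sum /=; apply: eq_bigr => i _.
by apply: pihomogM_form; apply: gen_homog.
Qed.

Lemma form_syzP d u : (ds <= d)%N -> (forall i, u i \is d.-homog) ->
  \sum_i u i * g i = 0 ->
  exists c, (forall j, c j \is (d - sdeg j).-homog) /\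
    forall i, u i = \sum_j c j * s j i.
Proof.
move=> le_bd ud /(syzP (p := F))[c uc]; exists (fun j => cofactor_part d (sdeg j) (c j)).
split=> [j|i].
  by apply: cofactor_partP; apply: leq_trans le_bd; apply: sdeg_le.
rewrite -[LHS](pihomog_dE (ud i)) uc raddf_sum /=; apply: eq_bigr => j _.
by apply: pihomogM_form; apply: syz_homog.
Qed.

Lemma sub_syz (u : 'I_(ngen F) -> P) (c : 'I_(nsyz F) -> P) :
  \sum_i (u i - \sum_j c j * s j i) * g i = \sum_i u i * g i.
Proof.
under eq_bigr do rewrite mulrBl mulr_suml.
rewrite big_split /= sumrN exchange_big /= [X in _ - X]big1 ?subr0 // => j _.
under eq_bigr do rewrite -mulrA.
by rewrite -mulr_sumr syz_rel mulr0.
Qed.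
End Presentation.

Section Interpolation.
Variable K : fieldType.
Local Notation P := {mpoly K[3]}.
Variables (Z : seq 'rV[K]_3) (dg ds : nat) (F : presentation Z dg ds).
Hypothesis ppZ : projective_points Z.
Local Notation g := (gen (p := F)).
Local Notation s := (syz (p := F)).

(** If X and x_i h differ by an element of the ideal, the values of h are those
    of X divided by x_i; only the part of h in degree e matters. *)
Lemma divided_value e i (X h G : P) (phi : 'rV[K]_3 -> K) :
  X \is e.+1.-homog -> (forall v, v \in Z -> X.@[v 0] = v 0 i * phi v) ->
  points_ideal Z G -> X + G = 'X_i * h ->
  forall v, v \in Z -> v 0 i * (pihomog mdeg e h).@[v 0] = v 0 i * phi v.
Proof.
move=> Xe Xv ZG XG v vZ; rewrite -Xv //.
have := congr1 (pihomog mdeg e.+1) XG.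
rewrite pihomogD (pihomog_dE Xe) mulrC (@pihomogM_form _ _ _ 1); last first.
  by rewrite dhomogX /= mdeg1.
rewrite /cofactor_part /= subn1 /= => /(congr1 (meval (v 0))).
rewrite mevalD mevalM mevalXU [_ * v 0 i]mulrC => <-.
rewrite (@points_ideal_eval _ _ Z (pihomog mdeg e.+1 G)) ?addr0 //.
by have [_ h'] := points_ideal_hom Z; apply: h'.
Qed.

(** Let X, Y, W be forms of degree e + 1 with values x0 phi, x1 phi, x2 phi on Z.
    The minors x1 X - x0 Y, x2 Y - x1 W, x0 W - x2 X vanish on Z, so they are
    combinations A, B, C of the generators, and x2 A + x0 B + x1 C is a syzygy.
    Its degree exceeds that of the basic syzygies, so it is a combination of
    these with coefficients in (x0, x1, x2); subtracting syzygies from A, B, C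
    one may assume that x2 A + x0 B + x1 C = 0.  Koszul exactness then corrects
    X, Y, W by elements of the ideal to x0 h, x1 h, x2 h for a single h, whose
    values are phi. *)
Lemma interpolates_pred e : (dg + ds <= e + 2)%N ->
  interpolates Z e.+1 -> interpolates Z e.
Proof.
move=> le_e IH phi.
pose i0 := @Ordinal 3 0 isT; pose i1 := @Ordinal 3 1 isT.
pose i2 := @Ordinal 3 2 isT.
have [X [Xh Xv]] := IH (fun v => v 0 i0 * phi v).
have [Y [Yh Yv]] := IH (fun v => v 0 i1 * phi v).
have [W [Wh Wv]] := IH (fun v => v 0 i2 * phi v).
have minor i j (U V : P) : U \is e.+1.-homog -> V \is e.+1.-homog ->
    (forall v, v \in Z -> U.@[v 0] = v 0 i * phi v) ->
    (forall v, v \in Z -> V.@[v 0] = v 0 j * phi v) ->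
  exists u, (forall k, u k \is (e.+2 - dg).-homog) /\
    'X_j * U - 'X_i * V = \sum_k u k * g k.
  move=> Uh Vh Uv Vv; have XM k (T : P) : T \is e.+1.-homog ->
      'X_k * T \is e.+2.-homog.
    by move=> Th; apply: (@dhomogM _ _ _ 1 _ e.+1) => //; rewrite dhomogX /= mdeg1.
  have UVh : 'X_j * U - 'X_i * V \is e.+2.-homog by apply: rpredB; apply: XM.
  apply: form_genP => //; first by lia.
  apply: (points_ideal_form UVh) => v vZ.
  by rewrite mevalB !mevalM !mevalXU Uv // Vv //; ring.
have [A [Ah RA]] := minor i0 i1 X Y Xh Yh Xv Yv.
have [B [Bh RB]] := minor i1 i2 Y W Yh Wh Yv Wv.
have [C [Ch RC]] := minor i2 i0 W X Wh Xh Wv Xv.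
rewrite -/(x0 K) -/(x1 K) in RA; rewrite -/(x1 K) -/(x2 K) in RB.
rewrite -/(x0 K) -/(x2 K) in RC.
pose u k := x2 K * A k + x0 K * B k + x1 K * C k.
have uh k : u k \is (e.+2 - dg).+1.-homog.
  have XM i (T : P) : T \is (e.+2 - dg).-homog -> 'X_i * T \is (e.+2 - dg).+1.-homog.
    by move=> Th; apply: (@dhomogM _ _ _ 1 _ (e.+2 - dg)) => //; rewrite dhomogX /= mdeg1.
  by apply: rpredD; [apply: rpredD|]; apply: XM.
have u0 : \sum_k u k * g k = 0.
  transitivity (x2 K * (\sum_k A k * g k) + x0 K * (\sum_k B k * g k)
    + x1 K * (\sum_k C k * g k)).
    rewrite !mulr_sumr -!big_split /=; apply: eq_bigr => k _.
    by rewrite /u; ring.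
  by rewrite -RA -RB -RC; ring.
have [|c [ch uc]] := form_syzP _ uh u0; first by lia.
have cx j : exists pqr : P * P * P,
    c j = x0 K * pqr.1.1 + x1 K * pqr.1.2 + x2 K * pqr.2.
  have [|p [q [r]]] := homog_pos_decomp _ (ch j); last by exists (p, q, r).
  by have := sdeg_le j; lia.
have {cx} [D cD] := choice cx.
pose A' k := A k - \sum_j (D j).2 * s j k.
pose B' k := B k - \sum_j (D j).1.1 * s j k.
pose C' k := C k - \sum_j (D j).1.2 * s j k.
have kos k : exists pqr : P * P * P, [/\ A' k = x0 K * pqr.1.1 - x1 K * pqr.1.2,
    B' k = x1 K * pqr.2 - x2 K * pqr.1.1 & C' k = x2 K * pqr.1.2 - x0 K * pqr.2].
  have [|p [q [r H]]] := @koszul3 _ _ i2 i0 i1 (A' k) (B' k) (C' k) isT isT isT.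
    rewrite -/(x0 K) -/(x1 K) -/(x2 K).
    have : u k - \sum_j c j * s j k = 0 by rewrite uc subrr.
    rewrite (eq_bigr (fun j => x2 K * ((D j).2 * s j k)
      + x0 K * ((D j).1.1 * s j k) + x1 K * ((D j).1.2 * s j k))); last first.
      by move=> j _; rewrite cD; ring.
    rewrite !big_split /= -!mulr_sumr => <-.
    by rewrite /A' /B' /C' /u; ring.
  by exists (p, q, r).
have {kos} [E EP] := choice kos.
pose G1 := \sum_k (E k).1.2 * g k; pose G2 := \sum_k (E k).1.1 * g k.
pose G3 := \sum_k (E k).2 * g k.
have R1 : x1 K * X - x0 K * Y = x0 K * G2 - x1 K * G1.
  rewrite RA -(sub_syz A (fun j => (D j).2)) !mulr_sumr -sumrB.
  apply: eq_bigr => k _; rewrite -/(A' k); have [-> _ _] := EP k; ring.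
have R2 : x2 K * Y - x1 K * W = x1 K * G3 - x2 K * G2.
  rewrite RB -(sub_syz B (fun j => (D j).1.1)) !mulr_sumr -sumrB.
  apply: eq_bigr => k _; rewrite -/(B' k); have [_ -> _] := EP k; ring.
have [|q [Xq Yq]] := @koszul2 _ _ i1 i0 (X + G1) (- (Y + G2)) isT.
  rewrite -/(x0 K) -/(x1 K); apply/eqP; rewrite -(subrr (x1 K * X - x0 K * Y)) {2}R1.
  by apply/eqP; ring.
(* The third coordinate follows from the second minor, as x1 is not a zero divisor. *)
have WG : W + G3 = x2 K * - q.
  apply: (mulfI (mpolyX_neq0 K i1)); rewrite -/(x1 K).
  have -> : x1 K * (W + G3) = x2 K * (Y + G2).
    by apply/eqP; rewrite -subr_eq0; apply/eqP;
      rewrite -(subrr (x2 K * Y - x1 K * W)) {1}R2; ring.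
  by rewrite -[Y + G2]opprK Yq -/(x1 K); ring.
exists (pihomog mdeg e (- q)); split; first exact: pihomogP.
have XG : X + G1 = 'X_i0 * - q by rewrite Xq mulrN.
have YG : Y + G2 = 'X_i1 * - q by rewrite -[Y + G2]opprK Yq mulrN.
move=> v vZ; have [i vi] : exists i, v 0 i != 0.
  apply/existsP; apply: contraR (ppZ.2 _ vZ) => /existsPn v0.
  by apply/eqP/rowP => i; rewrite mxE; apply/eqP; rewrite -[_ == _]negbK.
apply: (mulfI vi); have [[e0|e1]|e2] : (i = i0 \/ i = i1) \/ i = i2.
- by case: i {vi} => [[|[|[|//]]] ilt]; [left; left | left; right | right];
    apply: val_inj.
- by rewrite e0; apply: (divided_value Xh Xv (lincomb_gen_in _) XG).
- by rewrite e1; apply: (divided_value Yh Yv (lincomb_gen_in _) YG).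
- by rewrite e2; apply: (divided_value Wh Wv (lincomb_gen_in _) WG).
Qed.

Lemma interpolates_ge e : (dg + ds <= e + 2)%N -> interpolates Z e.
Proof.
(* Descending induction from a degree in which isolating forms interpolate. *)
move=> le_e; have [k le_k] : exists k, (size Z <= e + k)%N.
  by exists (size Z); rewrite leq_addl.
elim: k e le_e le_k => [|k IH] e le_e le_k.
  by apply: interpolates_large => //; rewrite addn0 in le_k.
apply: interpolates_pred => //; apply: IH; first by lia.
by rewrite addSnnS.
Qed.
End Interpolation.

(** * Symbolic powers and ordinary powers in large degree *)

Section Containment.
Variables (n : nat) (K : fieldType).
Local Notation P := {mpoly K[n]}.
Variables (Z : seq 'rV[K]_n) (dg ds : nat) (F : presentation Z dg ds).
Hypothesis ppZ : projective_points Z.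
Hypothesis interpZ : forall e, (dg + ds <= e + 2)%N -> interpolates Z e.
Hypothesis ds_gt1 : (1 < ds)%N.
Local Notation g := (gen (p := F)).
Local Notation s := (syz (p := F)).
Local Notation Ip p := (points_ideal [:: p : 'rV[K]_n]).

Lemma Ip_pow_ideal p r : is_ideal (ideal_pow (Ip p) r).
Proof. exact: ideal_pow_ideal. Qed.

Lemma Ip_pow_gen p r h i : p \in Z -> ideal_pow (Ip p) r h ->
  ideal_pow (Ip p) r.+1 (h * g i).
Proof.
move=> pZ rh; apply: (ideal_powSr _ rh); first exact: points_ideal_ideal.
by apply: (points_ideal_sub pZ); apply: gen_in.
Qed.

(** The residues at p are prescribed as a fraction c_p / w_p.  A form sg of degree
    e with the right values leaves the residue c_p - w_p sg in I_p, which near p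
    is a combination of the generators; its coefficients matter modulo I_p^r
    only, and are interpolated in degree e - dg by induction. *)
Lemma fat_interpolation r e (N : 'rV[K]_n -> nat) (w c : 'rV[K]_n -> P) :
  (dg * r + ds <= e + 2)%N ->
  (forall p, p \in Z -> [/\ w p \is (N p).-homog, (w p).@[p 0] != 0
     & c p \is (e + N p).-homog]) ->
  exists f, f \is e.-homog /\
    forall p, p \in Z -> ideal_pow (Ip p) r (w p * f - c p).
Proof.
elim: r e N w c => [|r IH] e N w c le_e wc.
  by exists 0; split=> [|p pZ]; [exact: dhomog0 | exact: ideal_pow0].
have [|sg [sge sgv]] := interpZ (e := e) _ (fun p => (c p).@[p 0] / (w p).@[p 0]).
  by rewrite mulnS in le_e; lia.
have le_dg_e : (dg <= e)%N by rewrite mulnS in le_e; lia.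
have loc (p : 'rV[K]_n) : exists duh : nat * P * ('I_(ngen F) -> P), p \in Z ->
    [/\ duh.1.2 \is (duh.1.1).-homog, duh.1.2.@[p 0] != 0,
        forall i, duh.2 i \is (e - dg + (duh.1.1 + N p)).-homog
      & duh.1.2 * (c p - w p * sg) = \sum_i duh.2 i * g i].
  have [pZ|] := boolP (p \in Z); last by exists (0%N, 0, fun=> 0).
  have [wN wp cN] := wc p pZ.
  have [d [u [_ ud up uq]]] := isolating_form ppZ pZ.
  have rh : c p - w p * sg \is (e + N p).-homog.
    apply: rpredB => //; rewrite addnC; exact: dhomogM.
  have r0 : (c p - w p * sg).@[p 0] = 0.
    by rewrite mevalB mevalM sgv // mulrC divfK // subrr.
  have := isolate_in_ideal ud uq rh r0.
  move/(form_genP F _ (dhomogM ud rh)) => [|h [hh hE]]; first by lia.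
  exists (d, u, h) => _; split=> //= i.
  have -> : (e - dg + (d + N p) = d + (e + N p) - dg)%N by lia.
  exact: hh.
have [duh duhP] := choice loc.
have glob i : exists h, h \is (e - dg).-homog /\ forall p, p \in Z ->
    ideal_pow (Ip p) r ((duh p).1.2 * w p * h - (duh p).2 i).
  apply: (IH _ (fun p => (duh p).1.1 + N p)%N (fun p => (duh p).1.2 * w p)
    (fun p => (duh p).2 i)).
    by rewrite mulnS in le_e; lia.
  move=> p pZ; have [uh up hh _] := duhP p pZ; have [wN wp cN] := wc p pZ.
  by split=> //; [exact: dhomogM | rewrite mevalM mulf_neq0].
have [h hP] := choice glob.
exists (sg + \sum_i h i * g i); split.
  apply: rpredD => //; apply: rpred_sum => i _.
  have := dhomogM (hP i).1 (gen_homog i); by rewrite subnK.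
move=> p pZ; have [uh up hh hE] := duhP p pZ.
apply: (point_pow_cancel (ppZ.2 _ pZ) uh up).
have -> : (duh p).1.2 * (w p * (sg + \sum_i h i * g i) - c p) =
    \sum_i ((duh p).1.2 * w p * h i - (duh p).2 i) * g i.
  rewrite [RHS](eq_bigr (fun i => (duh p).1.2 * w p * (h i * g i)
    - (duh p).2 i * g i)); last by move=> i _; ring.
  by rewrite sumrB -mulr_sumr -hE; ring.
apply: ideal_sum => [|i _]; first exact: Ip_pow_ideal.
by apply: Ip_pow_gen => //; have [_] := hP i; apply.
Qed.

(** I_p^(r+1) is the product of I_p and I_p^r, and I_p is generated near p by the
    generators of I_Z. *)
Lemma local_lincomb r p d u f : p \in Z -> u \is d.-homog ->
  (forall q, q \in Z -> q != p -> u.@[q 0] = 0) ->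
  ideal_pow (Ip p) r.+1 f ->
  exists h, (forall i, ideal_pow (Ip p) r (h i)) /\ u * f = \sum_i h i * g i.
Proof.
move=> pZ ud uq.
pose J := [set f : P | exists h, (forall i, ideal_pow (Ip p) r (h i)) /\
  u * f = \sum_i h i * g i].
have iI := Ip_pow_ideal p r.
have iJ : is_ideal J.
  split.
  - exists (fun=> 0); split=> [i|]; first exact: ideal_zero.
    by rewrite mulr0 big1 // => i _; rewrite mul0r.
  - move=> f1 f2 [h1 [h1r e1]] [h2 [h2r e2]]; exists (fun i => h1 i + h2 i).
    split=> [i|]; first by apply: (ideal_add iI).
    rewrite mulrDr e1 e2 -big_split /=; apply: eq_bigr => i _.
    by rewrite mulrDl.
  - move=> c f1 [h [hr e]]; exists (fun i => c * h i).
    split=> [i|]; first by apply: (ideal_mul iI).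
    by rewrite mulrCA e mulr_sumr; apply: eq_bigr => i _; rewrite mulrA.
suff sub : ideal_pow (Ip p) r.+1 `<=` J by exact: sub.
rewrite ideal_powS; last exact: points_ideal_ideal.
apply: ideal_gen_min => // _ [x [y [xI yI ->]]].
have : Ip p `<=` [set x | points_ideal Z (u * x)].
  apply: ideal_gen_min.
    have iZ := points_ideal_ideal Z.
    split=> [|x1 x2 /= h1 h2|c x1 /= h1] /=.
    - by rewrite mulr0; apply: (ideal_zero iZ).
    - by rewrite mulrDr; apply: (ideal_add iZ).
    - by rewrite mulrCA; apply: (ideal_mul iZ).
  move=> x1 [[e x1e] x1p] /=; apply: (isolate_in_ideal ud uq x1e).
  by apply: x1p; rewrite mem_head.
move/(_ _ xI)/(genP F) => [v ev]; exists (fun i => v i * y); split=> [i|].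
  exact: (ideal_mul iI).
rewrite mulrA ev mulr_suml; apply: eq_bigr => i _; exact: mulrAC.
Qed.

(** Two ways to write f as a combination of the generators differ by a syzygy: a
    global one, with forms h as coefficients, and for each p one near p with
    coefficients in I_p^r.  Interpolating the coefficients of the syzygies at
    all p modulo I_p^r gives one global syzygy that moves all h into I^(r). *)
Lemma symbolic_sub_pow r d f : (dg * r + 2 * ds <= d + 2)%N ->
  f \is d.-homog -> symbolic_pow Z r f -> ideal_pow (points_ideal Z) r f.
Proof.
elim: r d f => [|r IH] d f le_d fd Sf; first exact: ideal_pow0.
rewrite mulnS in le_d.
have Zf : points_ideal Z f.
  apply: (points_ideal_form fd) => p pZ.
  apply: (@points_ideal_eval _ _ [:: p]); last exact: mem_head.
  apply/ideal_pow1; first exact: points_ideal_ideal.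
  by apply: (@ideal_powW _ _ _ 1 r.+1) => //; apply: Sf.
have [|h [hh fh]] := form_genP F _ fd Zf; first by lia.
have loc (p : 'rV[K]_n) : exists duc : nat * P * ('I_(nsyz F) -> P), p \in Z ->
    [/\ duc.1.2 \is (duc.1.1).-homog, duc.1.2.@[p 0] != 0,
        forall j, duc.2 j \is (d - dg - sdeg j + duc.1.1).-homog
      & forall i, ideal_pow (Ip p) r
          (duc.1.2 * h i - \sum_j duc.2 j * s j i)].
  have [pZ|] := boolP (p \in Z); last by exists (0%N, 0, fun=> 0).
  have [N [u [_ uN up uq]]] := isolating_form ppZ pZ.
  have [h' [h'r fh']] := local_lincomb pZ uN uq (Sf p pZ).
  pose h'' i := cofactor_part (N + d) dg (h' i).
  have h''r i : ideal_pow (Ip p) r (h'' i).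
    rewrite /h'' /cofactor_part; case: ifP => _.
      have [_ hom] := hom_ideal_pow r (points_ideal_hom [:: p]).
      exact: hom.
    exact: (ideal_zero (Ip_pow_ideal p r)).
  have fh'' : u * f = \sum_i h'' i * g i.
    rewrite -[LHS](pihomog_dE (dhomogM uN fd)) fh' raddf_sum /=.
    apply: eq_bigr => i _; exact: (pihomogM_form _ _ (gen_homog i)).
  (* The global and the local expression of u f differ by a syzygy. *)
  have syz0 : \sum_i (u * h i - h'' i) * g i = 0.
    rewrite (eq_bigr (fun i => u * (h i * g i) - h'' i * g i)); last first.
      by move=> i _; ring.
    by rewrite sumrB -mulr_sumr -fh -fh'' subrr.
  have [||c [ch cE]] := form_syzP (d := N + (d - dg)) _ _ syz0.
  - by lia.
  - move=> i; apply: rpredB; first exact: dhomogM.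
    have -> : (N + (d - dg) = N + d - dg)%N by lia.
    by apply: cofactor_partP; lia.
  exists (N, u, c) => _; split=> //= [j|i].
    have -> : (d - dg - sdeg j + N = N + (d - dg) - sdeg j)%N.
      by have := sdeg_le j; lia.
    exact: ch.
  by rewrite -cE opprB addrC subrK.
have [duc ducP] := choice loc.
have glob j : exists C, C \is (d - dg - sdeg j).-homog /\ forall p, p \in Z ->
    ideal_pow (Ip p) r ((duc p).1.2 * C - (duc p).2 j).
  apply: (@fat_interpolation _ _ (fun p => (duc p).1.1) (fun p => (duc p).1.2)
    (fun p => (duc p).2 j)).
    by have := sdeg_le j; lia.
  by move=> p pZ; have [uN up cN _] := ducP p pZ.
have [C CP] := choice glob.
pose k i := h i - \sum_j C j * s j i.
have kh i : k i \is (d - dg).-homog.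
  apply: rpredB; first exact: hh.
  apply: rpred_sum => j _; have := dhomogM (CP j).1 (syz_homog j i).
  by rewrite subnK //; have := sdeg_le j; lia.
have kS i : symbolic_pow Z r (k i).
  move=> p pZ; have [uN up cN hc] := ducP p pZ.
  apply: (point_pow_cancel (ppZ.2 _ pZ) uN up).
  have -> : (duc p).1.2 * k i = ((duc p).1.2 * h i - \sum_j (duc p).2 j * s j i)
      - \sum_j ((duc p).1.2 * C j - (duc p).2 j) * s j i.
    rewrite [X in _ - X](eq_bigr (fun j => (duc p).1.2 * (C j * s j i)
      - (duc p).2 j * s j i)); last by move=> j _; ring.
    by rewrite sumrB -mulr_sumr /k; ring.
  apply: (ideal_sub (Ip_pow_ideal p r)); first exact: hc.
  apply: ideal_sum => [|j _]; first exact: Ip_pow_ideal.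
  by apply: (ideal_mulr _ (Ip_pow_ideal p r)); have [_] := CP j; apply.
rewrite fh -(sub_syz h C); apply: ideal_sum => [|i _]; first exact: ideal_pow_ideal.
apply: ideal_powSr; [exact: points_ideal_ideal | | exact: gen_in].
by apply: (IH (d - dg)%N (k i)); [lia | exact: kh | exact: kS].
Qed.
End Containment.

(** * Reading the presentation off a minimal free resolution *)

Section FromResolution.
Variables (n : nat) (K : fieldType).
Local Notation P := {mpoly K[n]}.

Lemma xget_nondefault (T : choiceType) (x0 x : T) (S : set T) :
  xget x0 S = x -> x <> x0 -> S x.
Proof. by case: xgetP => [y yE Sy <- //|_ -> /(_ erefl)]. Qed.

Lemma alphaP (I : set P) d : (0 < d)%N -> alpha I = d ->
  forall e f, I f -> f != 0 -> f \is e.-homog -> (d <= e)%N.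
Proof. by move=> d0 /xget_nondefault[|_]; first lia. Qed.

Lemma alpha_degree_ge (I : set P) d : (0 < d)%N -> hom_ideal I ->
  alpha I = d -> I `<=` degree_ge d.
Proof.
move=> d0 [_ hI] al f If e lt_e; apply/eqP; apply/negPn/negP => fe0.
have := alphaP d0 al (hI e f If) fe0 (pihomogP mdeg e f).
by rewrite leqNgt lt_e.
Qed.

(** The degree of a minimal generator lies between alpha and omega. *)
Lemma omega_generated (I : set P) d : (0 < d)%N ->
  alpha I = d -> omega I = d ->
  I = ideal_gen [set f | I f /\ f \is d.-homog].
Proof.
move=> d0 al /xget_nondefault[|k [g [e [[ge gI _] dE]]]]; first by lia.
have Ig i : I (g i) by rewrite -gI; apply: ideal_gen_in; exists i.
apply/seteqP; split; last first.
  by apply: ideal_gen_min => [|f []//]; rewrite -gI; apply: ideal_gen_ideal.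
rewrite -{1}gI; apply: ideal_gen_min; first exact: ideal_gen_ideal.
move=> _ [i _ <-]; apply: ideal_gen_in; split=> //.
have [->|gi0] := eqVneq (g i) 0; first exact: dhomog0.
suff <- : e i = d by [].
apply/eqP; rewrite eqn_leq (alphaP d0 al (Ig i) gi0 (ge i)) andbT dE.
exact: (@leq_bigmax _ e i).
Qed.

Section Resolution.
Variables (I : set P) (d : nat) (F : min_free_resolution I).
Hypotheses (d_gt0 : (0 < d)%N) (hI : hom_ideal I).
Hypotheses (al : alpha I = d) (om : omega I = d).

Let aug (p : 'I_(rk F 0)) : P := augm F p 0.

Lemma augm_lincomb (u : 'rV[P]_(rk F 0)) :
  (u *m augm F) 0 0 = \sum_p u 0 p * aug p.
Proof. by rewrite mxE. Qed.

Lemma augm_syz_const (u : 'rV[P]_(rk F 0)) p :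
  \sum_p u 0 p * aug p = 0 -> (u 0 p)@_0%MM = 0.
Proof.
rewrite -augm_lincomb => u0; have : u *m augm F = 0.
  by apply/matrixP => i j; rewrite !ord1 u0 mxE.
move/augm_exact => [v ->]; rewrite mxE raddf_sum big1 // => q _ /=.
have /= -> := rmorphM (@mcoeff n K 0%MM : {rmorphism P -> K}) (v 0 q) (diff F 0 q p).
by rewrite diff_minimal mulr0.
Qed.

Lemma augm_in p : I (aug p).
Proof.
apply/(augm_image F); exists (delta_mx 0 p).
by rewrite -rowE mxE.
Qed.

(** Minimality of the resolution: a redundant generator would give a syzygy with
    an entry that has constant term 1. *)
Lemma augm_not_lincomb p (w : 'I_(rk F 0) -> P) :
  w p = 0 -> aug p <> \sum_q w q * aug q.
Proof.
move=> wp augE.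
have := @augm_syz_const (\row_q ((q == p)%:R - w q)) p.
rewrite mxE eqxx wp subr0 mcoeff1 eqxx => H.
suff /H /eqP : \sum_q (\row_q0 ((q0 == p)%:R - w q0)) 0 q * aug q = 0.
  by rewrite oner_eq0.
rewrite (eq_bigr (fun q => (q == p)%:R * aug q - w q * aug q)); last first.
  by move=> q _; rewrite mxE mulrBl.
rewrite sumrB -augE (bigD1 p) //= eqxx mul1r big1 ?addr0 ?subrr // => q.
by move/negbTE->; rewrite mul0r.
Qed.

(** Forms of degree d generate I, so a generator of larger degree would be a
    combination of the others. *)
Lemma augm_shift p : @shift n K I F 0 p = d.
Proof.
have augp := @augm_homog _ _ _ F p.
apply/eqP; rewrite eqn_leq; apply/andP; split; last first.
  apply: (alphaP d_gt0 al (augm_in p)) augp; apply/eqP => p0.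
  by apply: (@augm_not_lincomb p (fun=> 0)) => //; rewrite big1 // => q _; rewrite mul0r.
rewrite leqNgt; apply/negP => lt_p.
pose J := [set f : P | exists w : 'I_(rk F 0) -> P,
  w p = 0 /\ f = \sum_q w q * aug q].
suff : I `<=` J by move/(_ _ (augm_in p)) => [w [/augm_not_lincomb]].
rewrite (omega_generated d_gt0 al om); apply: ideal_gen_min.
  split.
  - by exists (fun=> 0); split=> //; rewrite big1 // => q _; rewrite mul0r.
  - move=> f1 f2 [w1 [p1 e1]] [w2 [p2 e2]]; exists (fun q => w1 q + w2 q).
    split; first by rewrite p1 p2 addr0.
    by rewrite e1 e2 -big_split; apply: eq_bigr => q _; rewrite mulrDl.
  - move=> c f [w [p0 e]]; exists (fun q => c * w q); split.
      by rewrite p0 mulr0.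
    by rewrite e mulr_sumr; apply: eq_bigr => q _; rewrite mulrA.
move=> f [If fd]; have /(augm_image F) [u] := If; rewrite augm_lincomb => fu.
exists (fun q => cofactor_part d (@shift n K I F 0 q) (u 0 q)); split.
  exact: cofactor_part_lt.
rewrite -[LHS](pihomog_dE fd) fu raddf_sum /=; apply: eq_bigr => q _.
exact: pihomogM_form (@augm_homog _ _ _ F q).
Qed.
End Resolution.

Lemma presentation_of_regularity (Z : seq 'rV[K]_n) d rho :
  (0 < d)%N -> (0 < rho)%N ->
  alpha (points_ideal Z) = d -> omega (points_ideal Z) = d ->
  regularity (points_ideal Z) = rho ->
  inhabited (presentation Z d (rho.+1 - d)).
Proof.
move=> d0 r0 al om /xget_nondefault[|F [le_sh _]]; first by lia.
have hI := points_ideal_hom Z.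
have sh p : @shift n K _ F 0 p = d by apply: augm_shift.
constructor.
apply: (@Presentation _ _ Z d (rho.+1 - d) (rk F 0) (rk F 1)
  (fun i => augm F i 0) (fun j i => diff F 0 j i) (fun j => @shift n K _ F 1 j - d)%N).
- by move=> i; rewrite -{1}(sh i); apply: augm_homog.
- move=> f; split=> [/(augm_image F)[u]|[u ->]].
    by rewrite augm_lincomb => ->; exists (fun i => u 0 i).
  apply/(augm_image F); exists (\row_i u i); rewrite augm_lincomb.
  by apply: eq_bigr => i _; rewrite mxE.
- move=> j i; have [->|[k]] := @diff_homog _ _ _ F 0 j i; first exact: dhomog0.
  by rewrite sh => <-; rewrite addKn.
- by move=> j; have := le_sh 1%N j; lia.
- move=> u; have -> : (\sum_i u i * augm F i 0 = 0) <->
      (\row_i u i) *m augm F = 0.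
    have E : \sum_i u i * augm F i 0 = ((\row_i u i) *m augm F) 0 0.
      by rewrite augm_lincomb; apply: eq_bigr => i _; rewrite mxE.
    rewrite E; split=> [u0|->]; last by rewrite mxE.
    by apply/matrixP => i j; rewrite !ord1 u0 mxE.
  rewrite augm_exact; split=> [[v uv]|[c uc]].
    exists (fun j => v 0 j) => i; have /rowP/(_ i) := uv.
    by rewrite !mxE.
  exists (\row_j c j); apply/rowP => i; rewrite !mxE uc.
  by apply: eq_bigr => j _; rewrite mxE.
Qed.
End FromResolution.

(** * Coordinates adapted to a line, and restriction to a line *)

Section LineGeometry.
Variable K : fieldType.
Implicit Types (c : 'cV[K]_3) (p q r : 'rV[K]_3).

(** The rows q, p, w are a basis, with p and q on the line c = 0, and al, be, c
    is the dual basis of linear forms. *)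
Lemma line_coordinates c p : c != 0 -> p != 0 -> p *m c = 0 ->
  exists (q w : 'rV[K]_3) (al be : 'cV[K]_3),
    [/\ q *m c = 0, ~~ (q <= p)%MS & 1%:M = al *m q + be *m p + c *m w].
Proof.
move=> c0 p0 pc.
have rk_c : \rank c = 1%N.
  by rewrite -mxrank_tr rank_rV -(inj_eq (@trmx_inj _ _ _)) trmxK trmx0 c0.
have rk_ker : \rank (kermx c) = 2 by rewrite mxrank_ker rk_c.
have p_ker : (p <= kermx c)%MS by apply/sub_kermxP.
have [i nsub] : exists i, ~~ (row i (kermx c) <= p)%MS.
  apply/existsP; apply: contraT => /existsPn sub.
  have : (kermx c <= p)%MS by apply/row_subP => i; have := sub i; rewrite negbK.
  by move/mxrankS; rewrite rk_ker rank_rV p0.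
set q := row i (kermx c) in nsub.
have qc : q *m c = 0 by rewrite -row_mul mulmx_ker row0.
have q_ker : (q <= kermx c)%MS by apply/sub_kermxP.
have sub_qp : (kermx c <= col_mx q p)%MS.
  have le : (col_mx q p <= kermx c)%MS by rewrite col_mx_sub q_ker.
  have [_ <-] := mxrank_leqif_sup le; rewrite rk_ker eqn_leq rank_leq_row /=.
  rewrite -addsmxE.
  have [lt|] := ltnP (\rank (q + p)%MS) 2; last by [].
  case/negP: nsub; have le_p : (p <= q + p)%MS by apply: addsmxSr.
  have [le1 eq1] := mxrank_leqif_sup le_p; rewrite rank_rV p0 in le1 eq1.
  have rk1 : \rank (q + p)%MS = 1%N by apply/eqP; rewrite eqn_leq le1 andbT -ltnS.
  move: eq1; rewrite rk1 eqxx => /esym; apply: submx_trans.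
  exact: addsmxSl.
have [j cj] : exists j, c j 0 != 0.
  apply/existsP; apply: contraR c0 => /existsPn c0.
  by apply/eqP/colP => j; rewrite mxE; apply/eqP; rewrite -[_ == _]negbK.
pose w : 'rV[K]_3 := (c j 0)^-1 *: delta_mx 0 j.
have wc : w *m c = 1%:M.
  apply/matrixP => a b; rewrite !ord1 -scalemxAl -rowE !mxE mulVf //.
have /submxP [D DE] : (1%:M - c *m w <= col_mx q p)%MS.
  apply: submx_trans sub_qp; apply/sub_kermxP.
  by rewrite mulmxBl mul1mx -mulmxA wc mulmx1 subrr.
exists q, w, (lsubmx D), (rsubmx D); split=> //.
by rewrite -mul_row_col hsubmxK -DE subrK.
Qed.

Section Coordinates.
Variables (c : 'cV[K]_3) (p q w : 'rV[K]_3) (al be : 'cV[K]_3).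
Hypotheses (p0 : p != 0) (pc : p *m c = 0) (qc : q *m c = 0).
Hypothesis nqp : ~~ (q <= p)%MS.
Hypothesis id_qpw : 1%:M = al *m q + be *m p + c *m w.

Lemma on_line_decomp r : r *m c = 0 ->
  r = (r *m al) 0 0 *: q + (r *m be) 0 0 *: p.
Proof.
move=> rc; rewrite -{1}[r]mulmx1 id_qpw !mulmxDr !mulmxA rc mul0mx addr0.
by rewrite {1}[r *m al]mx11_scalar {1}[r *m be]mx11_scalar !mul_scalar_mx.
Qed.

Lemma line_independent (x y : K) : x *: q + y *: p = 0 -> x = 0 /\ y = 0.
Proof.
move=> xy; have x0 : x = 0.
  apply/eqP; apply: contraNT nqp => x0; apply/submxP; exists (- (x^-1 * y))%:M.
  apply: (scalerI x0); rewrite mul_scalar_mx scalerA mulrN mulVKf // scaleNr.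
  by apply/eqP; rewrite -addr_eq0 xy.
split=> //; move: xy; rewrite x0 scale0r add0r => /eqP.
by rewrite scaler_eq0 (negbTE p0) orbF => /eqP.
Qed.

Lemma coord_q : (q *m al) 0 0 = 1 /\ (q *m be) 0 0 = 0.
Proof.
have [] := @line_independent ((q *m al) 0 0 - 1) ((q *m be) 0 0).
  by rewrite scalerBl scale1r addrAC -on_line_decomp // subrr.
by move/eqP; rewrite subr_eq0 => /eqP.
Qed.

Lemma coord_p : (p *m al) 0 0 = 0 /\ (p *m be) 0 0 = 1.
Proof.
have [] := @line_independent ((p *m al) 0 0) ((p *m be) 0 0 - 1).
  by rewrite scalerBl scale1r addrA -on_line_decomp // subrr.
by move=> -> /eqP; rewrite subr_eq0 => /eqP.
Qed.

Lemma coord_neq0 r : r *m c = 0 -> ~~ (r <= p)%MS -> (r *m al) 0 0 != 0.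
Proof.
move=> rc; apply: contraNneq => r0.
by rewrite (on_line_decomp rc) r0 scale0r add0r; apply: scalemx_sub.
Qed.

Lemma X_decomp i : 'X_i = linform al * (q 0 i)%:MP + linform be * (p 0 i)%:MP
  + linform c * (w 0 i)%:MP :> {mpoly K[3]}.
Proof.
have XE (u : 'cV[K]_3) (v : 'rV[K]_3) : linform u * (v 0 i)%:MP =
    \sum_j (u *m v) j i *: 'X_j :> {mpoly K[3]}.
  rewrite mulrC mul_mpolyC /linform scaler_sumr; apply: eq_bigr => j _.
  by rewrite scalerA mxE big_ord1 mulrC.
rewrite !XE -!big_split /=.
rewrite (eq_bigr (fun j => (1%:M : 'M[K]_3) j i *: 'X_j)); last first.
  by move=> j _; rewrite id_qpw -!scalerDl ![in RHS]mxE !mxE.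
rewrite (bigD1 i) //= mxE eqxx scale1r big1 ?addr0 // => j ji.
by rewrite mxE (negbTE ji) scale0r.
Qed.
End Coordinates.
End LineGeometry.

Lemma subst_mod_ideal (n : nat) (K : fieldType) (J : set {mpoly K[n]})
    (y : 'I_n -> {mpoly K[n]}) : is_ideal J -> (forall i, J ('X_i - y i)) ->
  forall f, J (f - mmap (@mpolyC n K) y f).
Proof.
move=> iJ Jy; pose sb : {rmorphism {mpoly K[n]} -> {mpoly K[n]}} := mmap (@mpolyC n K) y.
have: forall f, J (f - sb f).
  apply: mpoly_subring_ind => [c|i|f g Jf Jg|f g Jf Jg].
  - by rewrite /sb /= mmapC subrr; apply: (ideal_zero iJ).
  - by rewrite /sb /= mmapX mmap1U.
  - rewrite rmorphD opprD addrACA; exact: (ideal_add iJ Jf Jg).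
  - have -> : f * g - sb (f * g) = g * (f - sb f) + sb f * (g - sb g).
      by rewrite rmorphM; ring.
    exact: (ideal_add iJ (ideal_mul iJ _ Jf) (ideal_mul iJ _ Jg)).
by [].
Qed.

Section LineRestriction.
Variable K : fieldType.
Local Notation P := {mpoly K[3]}.
Implicit Types (f g : P) (p q r : 'rV[K]_3).

Definition on_line q p : P -> {poly K} :=
  mmap (@polyC K) (fun i => (q 0 i)%:P + 'X * (p 0 i)%:P).

HB.instance Definition _ q p := GRing.RMorphism.on (on_line q p).

Lemma on_lineM q p f g : on_line q p (f * g) = on_line q p f * on_line q p g.
Proof. exact: rmorphM. Qed.

Lemma on_lineD q p f g : on_line q p (f + g) = on_line q p f + on_line q p g.
Proof. exact: rmorphD. Qed.

Lemma on_line_horner q p t f : (on_line q p f).[t] = f.@[(q + t *: p) 0].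
Proof.
apply: (@mpoly_morphism_ext _ _ _ (horner_eval t \o on_line q p)
  (meval ((q + t *: p) 0))) => [c|i] /=.
  by rewrite /on_line mmapC /horner_eval hornerC mevalC.
rewrite /on_line mmapX mmap1U /horner_eval mevalXU affine_horner.
by rewrite !mxE mulrC.
Qed.

Lemma on_line_linform q p c :
  on_line q p (linform c) = ((q *m c) 0 0)%:P + 'X * ((p *m c) 0 0)%:P.
Proof.
rewrite /linform rmorph_sum !mxE !rmorph_sum mulr_sumr -big_split /=.
apply: eq_bigr => i _; rewrite -mul_mpolyC on_lineM /on_line mmapC mmapX mmap1U.
by rewrite !rmorphM /=; ring.
Qed.

Lemma size_on_line q p d f : f \is d.-homog -> (size (on_line q p f) <= d.+1)%N.
Proof.
have szM e1 e2 (A B : {poly K}) : (size A <= e1.+1)%N -> (size B <= e2.+1)%N ->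
    (size (A * B)%R <= (e1 + e2).+1)%N.
  by move=> hA hB; apply: leq_trans (size_polyMleq _ _) _; lia.
move/dhomogP => fd; rewrite /on_line /mmap.
rewrite big_seq; apply: (big_ind (fun A : {poly K} => (size A <= d.+1)%N)).
- by rewrite size_poly0.
- by move=> A B hA hB; apply: leq_trans (size_polyD _ _) _; rewrite geq_max hA.
move=> m /fd /= <-; rewrite mdegE -[X in (_ <= X.+1)%N]add0n; apply: (szM).
  exact: size_polyC_leq1.
rewrite /mmap1.
apply: (big_ind2 (fun (A : {poly K}) e => (size A <= e.+1)%N)).
- by rewrite size_poly1.
- by move=> A e B e'; apply: (szM).
move=> i _; set A := _ + _; have hA : (size A <= 2)%N.
  apply: leq_trans (size_polyD _ _) _; rewrite geq_max.
  rewrite (leq_trans (size_polyC_leq1 _)) //=.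
  by apply: (szM 1%N 0%N); rewrite ?size_polyX ?size_polyC_leq1.
elim: (m i) => [|k IH]; first by rewrite expr0 size_poly1.
by rewrite exprS -add1n; apply: (szM 1%N k).
Qed.

Lemma on_line_dvd q p t r m f : r = q + t *: p ->
  ideal_pow (points_ideal [:: r]) m f -> ('X - t%:P) ^+ m %| on_line q p f.
Proof.
move=> rE; move: m f.
apply: (@ideal_pow_filtration _ _ _ (fun m => [set f | ('X - t%:P) ^+ m %| on_line q p f])).
- move=> m; split=> [|f g /= hf hg|c f /= hf] /=.
  + by rewrite [on_line _ _ 0]rmorph0 dvdp0.
  + by rewrite on_lineD; apply: dvdp_add.
  + by rewrite on_lineM; apply: dvdp_mull.
- by rewrite /= expr0 dvd1p.
- move=> f hf /=; rewrite expr1 dvdp_XsubCl /root on_line_horner -rE.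
  by rewrite (points_ideal_eval hf) ?mem_head.
- by move=> m f g /=; rewrite expr1 on_lineM exprS; apply: dvdp_mul.
Qed.
End LineRestriction.

(** * Lines with too many zeros split off *)

Section LineDivision.
Variable K : fieldType.
Local Notation P := {mpoly K[3]}.
Implicit Types (c : 'cV[K]_3) (p q r : 'rV[K]_3) (B Z : seq 'rV[K]_3).

Definition incident p c : bool := p *m c == 0.

(** The forms al and c generate I_p. *)
Lemma line_point_expansion c p q w al be : 
  1%:M = al *m q + be *m p + c *m w ->
  forall m f, ideal_pow (points_ideal [:: p]) m f ->
  exists h h', f = linform al ^+ m * h + linform c * h'.
Proof.
move=> id_qpw.
pose J m := [set f : P | exists h h', f = linform al ^+ m * h + linform c * h'].
have iJ m : is_ideal (J m).
  split=> [|_ _ [h1 [k1 ->]] [h2 [k2 ->]]|x _ [h [k ->]]].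
  - by exists 0, 0; rewrite !mulr0 addr0.
  - by exists (h1 + h2), (k1 + k2); ring.
  - by exists (x * h), (x * k); ring.
have J1 : points_ideal [:: p] `<=` J 1%N.
  apply: ideal_gen_min => // g [[d gd] gp].
  have := @subst_mod_ideal _ _ (J 1%N) (fun i => linform be * (p 0 i)%:MP) (iJ 1%N) _ g.
  rewrite (mmap_homog _ _ _ gd) mmap_mpolyC_eval gp ?mem_head //.
  rewrite mpolyC0 mulr0 subr0; apply=> i.
  exists (q 0 i)%:MP, (w 0 i)%:MP; rewrite (X_decomp id_qpw i) expr1.
  by ring.
move=> m f; apply: (@ideal_pow_filtration _ _ _ J) => //.
- by exists 1, 0; rewrite expr0 mulr0 mulr1 addr0.
- move=> k _ _ [h1 [k1 ->]] [h2 [k2 ->]]; rewrite expr1.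
  exists (h1 * h2), (linform al * h1 * k2 + k1 * linform al ^+ k * h2
    + linform c * k1 * k2).
  by rewrite exprS; ring.
Qed.

(** Modulo c, the form f becomes f(al q + be p), and this is
    al^d f(q + (be / al) p) in the field of fractions. *)
Lemma on_line_eq0 c p q w al be d f : 1%:M = al *m q + be *m p + c *m w ->
  al != 0 -> f \is d.-homog -> on_line q p f = 0 -> exists h, f = linform c * h.
Proof.
move=> id_qpw al0 fd f0.
pose J := [set f : P | exists h, f = linform c * h].
have iJ : is_ideal J.
  split=> [|_ _ [h1 ->] [h2 ->]|x _ [h ->]].
  - by exists 0; rewrite mulr0.
  - by exists (h1 + h2); rewrite mulrDr.
  - by exists (x * h); rewrite mulrCA.
pose y i : P := linform al * (q 0 i)%:MP + linform be * (p 0 i)%:MP.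
have Jy i : J ('X_i - y i).
  by exists (w 0 i)%:MP; rewrite (X_decomp id_qpw i) /y; ring.
have := subst_mod_ideal iJ Jy f.
suff -> : mmap (@mpolyC 3 K) y f = 0 by rewrite subr0.
pose Fr := {fraction P}.
pose inj : {rmorphism K -> Fr} := (@tofrac P) \o (@mpolyC 3 K).
have l0 : tofrac (linform al) != 0 :> Fr by rewrite tofrac_eq0 linform_eq0.
apply/eqP; rewrite -tofrac_eq0; apply/eqP.
pose t : Fr := tofrac (linform be) / tofrac (linform al).
pose y' i : Fr := inj (q 0 i) + inj (p 0 i) * t.
transitivity (mmap inj (fun i => tofrac (linform al) * y' i) f).
  apply: (@mpoly_morphism_ext _ _ _ ((@tofrac P) \o mmap (@mpolyC 3 K) y)
    (mmap inj (fun i => tofrac (linform al) * y' i))) => [x|i] /=.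
    by rewrite !mmapC.
  rewrite !mmapX !mmap1U /y /y' tofracD !tofracM mulrDr [_ * t]mulrC mulrA.
  by rewrite /t [tofrac (linform al) * (_ / _)]mulrC divfK.
rewrite (mmap_homog _ _ _ fd).
have -> : mmap inj y' f = (map_poly inj (on_line q p f)).[t].
  apply: (@mpoly_morphism_ext _ _ _ (mmap inj y')
    (horner_eval t \o (map_poly inj \o on_line q p))) => [x|i] /=.
    by rewrite /on_line !mmapC map_polyC /= /horner_eval hornerC.
  rewrite /on_line !mmapX !mmap1U /horner_eval; exact/esym/map_affine_horner.
by rewrite f0 rmorph0 horner0 mulr0.
Qed.

Lemma dvd_prod_XsubC (T : eqType) (s : seq T) (tau : T -> K) (m : T -> nat)
    (A : {poly K}) : uniq [seq tau x | x <- s] ->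
  (forall x, x \in s -> ('X - (tau x)%:P) ^+ m x %| A) ->
  \prod_(x <- s) ('X - (tau x)%:P) ^+ m x %| A.
Proof.
elim: s => [|x s IH] /=; first by rewrite big_nil dvd1p.
move=> /andP[xs us] dv; rewrite big_cons Gauss_dvdp.
  rewrite dv ?mem_head // IH // => y ys; apply: dv; by rewrite inE ys orbT.
apply: coprimep_expl; rewrite coprimep_sym coprimep_XsubC /root horner_prod.
rewrite prodf_seq_neq0; apply/allP => y ys /=.
rewrite horner_exp expf_neq0 // hornerXsubC subr_eq0.
by apply: contraNneq xs => ->; apply: map_f.
Qed.

Lemma size_prod_XsubC_exp (T : Type) (s : seq T) (tau : T -> K) (m : T -> nat) :
  size (\prod_(x <- s) ('X - (tau x)%:P) ^+ m x) = (\sum_(x <- s) m x).+1.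
Proof.
elim: s => [|x s IH]; first by rewrite !big_nil size_poly1.
rewrite !big_cons size_monicM ?IH ?size_exp_XsubC ?addSn ?addnS //.
  by apply: monic_exp; apply: monicXsubC.
by rewrite -size_poly_eq0 IH.
Qed.

(** On the line parametrized by q + T p, the zero of f at p, of order m p, lowers
    the degree in T, since p is at infinity, and a zero at another point r gives
    a factor (T - tau r)^(m r); together these exceed the degree d. *)
Lemma line_divides c B (m : 'rV[K]_3 -> nat) d f : c != 0 ->
  projective_points B -> (forall p, p \in B -> p *m c = 0) ->
  f \is d.-homog ->
  (forall p, p \in B -> ideal_pow (points_ideal [:: p]) (m p) f) ->
  (d < \sum_(p <- B) m p)%N -> exists h, f = linform c * h.
Proof.
move=> c0 ppB Bc fd fm; case: B => [|p B] in ppB Bc fm *; first by rewrite big_nil.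
rewrite big_cons => lt_d.
have pB : p \in p :: B by exact: mem_head.
have p0 := ppB.2 _ pB; have pc := Bc _ pB.
have [q [w [al [be [qc nqp id_qpw]]]]] := line_coordinates c0 p0 pc.
have [qal qbe] := coord_q p0 qc nqp id_qpw.
have [pal pbe] := coord_p p0 pc nqp id_qpw.
have al0 : al != 0.
  by apply: contraTneq (oner_neq0 K) => al0; rewrite -qal al0 mulmx0 mxE eqxx.
(* A form of degree d that vanishes at p to a larger order is zero. *)
have [lt_dm|le_md] := ltnP d (m p).
  exists 0; rewrite mulr0; apply: contraTeq lt_dm => f0; rewrite -leqNgt.
  apply: (degree_ge_form _ fd f0); rewrite -[m p]mul1n.
  exact: (degree_ge_pow (point_ideal_degree_ge p0) (fm p pB)).
apply: (on_line_eq0 id_qpw al0 fd).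
have [h [h' fE]] := line_point_expansion id_qpw (fm p pB).
have f_line : on_line q p f = on_line q p (cofactor_part d (m p) h).
  rewrite -{1}(pihomog_dE fd) fE pihomogD [_ * h]mulrC [_ * h']mulrC.
  rewrite (@pihomogM_form _ _ _ (m p)); last first.
    by have := dhomogMn (m p) (linform_homog al); rewrite mul1n.
  rewrite (@pihomogM_form _ _ _ 1); last exact: linform_homog.
  rewrite on_lineD !on_lineM rmorphXn /= !on_line_linform qal pal qc pc !mxE.
  by rewrite !polyC0 !mulr0 !addr0 expr1n mulr1 mulr0 addr0.
have sz : (size (on_line q p f) <= (d - m p).+1)%N.
  by rewrite f_line; apply: size_on_line; apply: cofactor_partP.
pose tau r := (r *m be) 0 0 / (r *m al) 0 0.
have in_B r : r \in B -> [/\ r \in p :: B, r *m c = 0 & (r *m al) 0 0 != 0].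
  move=> rB; have rpB : r \in p :: B by rewrite inE rB orbT.
  split=> //; first exact: Bc.
  apply: (coord_neq0 id_qpw (Bc _ rpB)).
  apply: (points_not_proportional ppB) => //; apply: contraTneq rB => ->.
  by have /andP[] := projective_points_uniq ppB.
have tauE r : r \in B -> (r *m al) 0 0 *: (q + tau r *: p) = r.
  move=> /in_B[_ rc r0]; rewrite [RHS](on_line_decomp id_qpw rc).
  by rewrite scalerDr scalerA mulrC divfK.
have dv r : r \in B -> ('X - (tau r)%:P) ^+ m r %| on_line q p f.
  move=> rB; have [rpB rc r0] := in_B r rB.
  apply: (on_line_dvd (erefl _)).
  have -> : points_ideal [:: q + tau r *: p] = points_ideal [:: r]; last exact: fm.
  rewrite -{2}(tauE r rB); congr ideal_gen; apply/seteqP.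
  have ev e (g : P) : g \is e.-homog ->
      g.@[((r *m al) 0 0 *: (q + tau r *: p)) 0] =
      (r *m al) 0 0 ^+ e * g.@[(q + tau r *: p) 0].
    by move=> ge; rewrite -(homog_eval_scale _ _ ge); apply: meval_eq => i; rewrite mxE.
  split=> g [[e ge] g0]; (split; first by exists e) => v; rewrite inE => /eqP->.
    by rewrite (ev _ _ ge) g0 ?mem_head // mulr0.
  apply/eqP; have := g0 _ (mem_head _ _); rewrite (ev _ _ ge) => /eqP.
  by rewrite mulf_eq0 expf_eq0 (negbTE r0) andbF.
have uB : uniq [seq tau r | r <- B].
  rewrite map_inj_in_uniq; first by have /andP[] := projective_points_uniq ppB.
  move=> r r' rB r'B eq_tau; apply/eqP; apply: contraT => ne.
  have [rpB _ r0] := in_B r rB; have [r'pB _ r'0] := in_B r' r'B.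
  have /negP[] := points_not_proportional ppB rpB r'pB ne.
  rewrite -(tauE r rB) -(tauE r' r'B) eq_tau.
  apply: scalemx_sub; rewrite -[X in (X <= _)%MS]scale1r -(mulVf r'0) -scalerA.
  exact: scalemx_sub.
apply: contraTeq lt_d => f0; rewrite -leqNgt.
have := dvdp_leq f0 (dvd_prod_XsubC uB dv); rewrite size_prod_XsubC_exp.
by move=> /leq_trans /(_ sz); rewrite ltnS -(leq_add2l (m p)) subnKC.
Qed.

Lemma projective_points_filter (Q : pred 'rV[K]_3) B :
  projective_points B -> projective_points (filter Q B).
Proof.
move=> [dB nB]; split; last by move=> v; rewrite mem_filter => /andP[_ /nB].
by apply: subseq_uniq dB; apply: map_subseq; apply: filter_subseq.
Qed.

(** The sum of the lines L j behaves as a nef divisor of degree k through B.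
    Either the orders on each L j sum up to at most d, and summing over j gives
    the bound, or some L j divides f; dividing by it lowers k * d by k and the
    sum of the orders by at most the number of points of B on L j. *)
Lemma lines_degree_bound k (L : 'I_k -> 'cV[K]_3) B :
  projective_points B -> (forall j, L j != 0) ->
  (forall p, p \in B -> (\sum_j incident p (L j))%N = 1%N) ->
  (forall j, (count (fun p => incident p (L j)) B <= k)%N) ->
  forall d f (m : 'rV[K]_3 -> nat), f \is d.-homog -> f != 0 ->
  (forall p, p \in B -> ideal_pow (points_ideal [:: p]) (m p) f) ->
  (\sum_(p <- B) m p <= k * d)%N.
Proof.
move=> ppB L0 L1 Lk; elim/ltn_ind => d IH f m fd f0 fm.
have [/existsP[j lt_j]|/existsPn le_j] :=
    boolP [exists j, d < \sum_(p <- B | incident p (L j)) m p]%N; last first.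
  have -> : (\sum_(p <- B) m p = \sum_j \sum_(p <- B | incident p (L j)) m p)%N.
    rewrite (eq_bigr (fun j => \sum_(p <- B) incident p (L j) * m p)%N); last first.
      by move=> j _; rewrite big_mkcond; apply: eq_bigr => p _; case: ifP; lia.
    rewrite exchange_big /= !big_seq; apply: eq_bigr => p pB.
    by rewrite -big_distrl /= L1 // mul1n.
  apply: (@leq_trans (\sum_(j < k) d)%N); last by rewrite sum_nat_const card_ord.
  by apply: leq_sum => j _; rewrite leqNgt; apply: le_j.
have [|||h fE] := @line_divides (L j) (filter (fun p => incident p (L j)) B) m d f (L0 j)
    (projective_points_filter _ ppB) _ fd.
- by move=> p; rewrite mem_filter => /andP[/eqP].
- by move=> p; rewrite mem_filter => /andP[_ /fm].
- by rewrite big_filter.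
pose h1 := cofactor_part d 1 h.
have {}fE : f = linform (L j) * h1.
  rewrite -[LHS](pihomog_dE fd) fE mulrC (@pihomogM_form _ _ _ 1) 1?mulrC //.
  exact: linform_homog.
have d_gt0 : (0 < d)%N.
  by rewrite lt0n; apply: contraNneq f0 => d0; rewrite fE /h1 d0 cofactor_part_lt ?mulr0.
have h1d : h1 \is d.-1.-homog by rewrite -subn1; apply: cofactor_partP.
have h10 : h1 != 0 by apply: contraNneq f0 => h10; rewrite fE h10 mulr0.
(* The order of h1 is one less at the points of B on L j, and the same elsewhere. *)
have le_IH : (\sum_(p <- B) (m p - incident p (L j)) <= k * d.-1)%N.
  apply: (IH _ _ h1 (fun p => m p - incident p (L j))%N) => //; first by lia.
  move=> p pB; have p0 := ppB.2 _ pB; have := fm p pB; rewrite fE.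
  rewrite /incident; case: eqP => [pL|/eqP pL].
    by rewrite subn1; apply: point_pow_cancel_linform.
  rewrite subn0; apply: (point_pow_cancel p0 (linform_homog (L j))).
  rewrite linform_eval; apply: contraNneq pL => pL; apply/eqP/matrixP => x y.
  by rewrite !ord1 pL mxE.
have le_m : (\sum_(p <- B) m p <=
    \sum_(p <- B) (m p - incident p (L j)) + count (fun p => incident p (L j)) B)%N.
  rewrite -sum1_count [X in (_ + X)%N]big_mkcond -big_split /=.
  by apply: leq_sum => p _; case: incident => /=; lia.
apply: leq_trans le_m _; rewrite -(prednK d_gt0) mulnS addnC.
by apply: leq_add.
Qed.

(** By restriction, a line with more than d points of Z would divide the forms of
    degree d of the ideal, hence all of it.  But an isolating form at a point p
    of the line, multiplied by a linear form that vanishes at p and not on the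
    whole line, is in the ideal and does not vanish on the line. *)
Lemma line_few_points c Z d : (0 < d)%N -> projective_points Z -> c != 0 ->
  points_ideal Z = ideal_gen [set f | points_ideal Z f /\ f \is d.-homog] ->
  (count (fun p => incident p c) Z <= d)%N.
Proof.
move=> d_gt0 ppZ c0 genZ; rewrite leqNgt; apply/negP => lt_d.
pose B := filter (fun p => incident p c) Z.
have ppB : projective_points B by apply: projective_points_filter.
have BP p : p \in B -> p \in Z /\ p *m c = 0.
  by rewrite mem_filter => /andP[/eqP pc pZ].
have sub : points_ideal Z `<=` [set f | exists h, f = linform c * h].
  rewrite genZ; apply: ideal_gen_min.
    split=> [|_ _ [h1 ->] [h2 ->]|x _ [h ->]].
    - by exists 0; rewrite mulr0.
    - by exists (h1 + h2); rewrite mulrDr.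
    - by exists (x * h); rewrite mulrCA.
  move=> f [Zf fd]; apply: (@line_divides c B (fun=> 1%N) d f) => //.
  - by move=> p /BP[].
  - move=> p /BP[pZ _]; apply/ideal_pow1; first exact: points_ideal_ideal.
    exact: (points_ideal_sub pZ).
  - by rewrite big_const_seq iter_addn addn0 mul1n count_predT size_filter.
have szB : (1 < size B)%N by rewrite size_filter; lia.
have [p [q [pB qB ne]]] : exists p q, [/\ p \in B, q \in B & q != p].
  have uB := projective_points_uniq ppB.
  case: B szB uB {ppB BP} => [|p [|q B']] //= _ /andP[pq _].
  exists p, q; rewrite !inE !eqxx orbT; split=> //.
  by apply: contraNneq pq => ->; rewrite mem_head.
have [pZ pc] := BP p pB; have [qZ qc] := BP q qB.
have [e [u [_ ue up uq]]] := isolating_form ppZ pZ.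
have [b [qb pb]] := separating_form (points_not_proportional ppZ qZ pZ ne).
have bp : (linform b).@[p 0] = 0 by rewrite linform_eval pb mxE.
have [h hE] := sub _ (isolate_in_ideal ue uq (linform_homog b) bp).
have := congr1 (on_line p q) hE; rewrite !on_lineM !on_line_linform pc qc pb.
have -> : (0 : 'M[K]_1) 0 0 = 0 by rewrite mxE.
rewrite !polyC0 mulr0 addr0 mul0r add0r => /eqP.
rewrite !mulf_eq0 polyX_eq0 polyC_eq0 (negbTE qb) !orbF => /eqP u0.
have := on_line_horner p q 0 u; rewrite u0 horner0 scale0r addr0 => /esym/eqP.
by rewrite (negbTE up).
Qed.
End LineDivision.

(** * The configuration of nineteen points *)

Lemma two_points_line (K : fieldType) (c c' : 'cV[K]_3) (p q r : 'rV[K]_3) :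
  c' != 0 -> p != 0 -> ~~ (q <= p)%MS -> incident p c -> incident p c' ->
  incident q c -> incident q c' -> incident r c' -> incident r c.
Proof.
move=> c'0 p0 nqp /eqP pc /eqP pc' /eqP qc /eqP qc' /eqP rc'.
have [a [w [al [be [ac' nap id]]]]] := line_coordinates c'0 p0 pc'.
have ac : a *m c = 0.
  apply: (scalerI (coord_neq0 id qc' nqp)).
  move: qc; rewrite {1}(on_line_decomp id qc') mulmxDl -!scalemxAl pc scaler0.
  by rewrite addr0 scaler0.
rewrite /incident (on_line_decomp id rc') mulmxDl -!scalemxAl pc ac.
by rewrite !scaler0 addr0.
Qed.

Lemma prod_linform_pow (n : nat) (K : fieldType) (p : 'rV[K]_n)
    (s : seq 'cV[K]_n) :
  ideal_pow (points_ideal [:: p]) (count (fun c => p *m c == 0) s)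
    (\prod_(c <- s) linform c).
Proof.
elim: s => [|c s IH] /=; first exact: ideal_pow0.
rewrite big_cons; apply: ideal_powM IH; case: eqP => [pc|_]; last exact: ideal_pow0.
apply/ideal_pow1; first exact: points_ideal_ideal.
by apply: (point_form_mem (linform_homog c)); rewrite linform_eval pc mxE.
Qed.

Lemma prod_linform_homog (n : nat) (K : fieldType) (s : seq 'cV[K]_n) :
  \prod_(c <- s) linform c \is (size s).-homog.
Proof.
elim: s => [|c s IH]; first by rewrite big_nil dhomog1.
by rewrite big_cons; apply: (dhomogM (linform_homog c) IH).
Qed.

Lemma ideal_powX (n : nat) (K : fieldType) (I : set {mpoly K[n]}) a f k :
  ideal_pow I a f -> ideal_pow I (a * k) (f ^+ k).
Proof.
move=> fa; elim: k => [|k IH]; first by rewrite muln0; apply: ideal_pow0.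
by rewrite exprS mulnS; apply: ideal_powM.
Qed.

Section Configuration.
Variables (K : fieldType) (t : K).
Local Notation Z := (points19 t).

Definition lines12 : seq 'cV[K]_3 := [seq v^T | v <- [::
  pt 1 0 0; pt 0 1 0; pt (- t) 1 0; pt 0 0 1; pt 1 0 (- 1); pt 1 1 (- 1);
  pt (- t) 1 (- 1); pt (t ^+ 2 + t + 1) (- t) (- 1); pt t t 1; pt 0 (t + 1) 1;
  pt (t ^+ 2 + t + 1) (- (t + 1)) (- 1);
  pt (t ^+ 2 + t + 1) (- t) (- (t ^+ 2 + 2%:R * t + 2%:R))]].

(** Row k lists points on the k-th line of [lines12]; A, ..., S are numbered 0 to
    18.  For generic t the lines through at least three of the points are these
    twelve, and the rows are complete. *)
Definition incidences : seq (seq nat) := [::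
  [:: 0; 1; 3; 11; 16]; [:: 0; 2; 4; 8; 12]; [:: 0; 5; 6; 9; 15];
  [:: 1; 2; 5; 10; 13]; [:: 1; 4; 6; 7; 14]; [:: 3; 4; 9; 10; 18];
  [:: 3; 5; 7; 8; 17]; [:: 7; 9; 11; 12; 13]; [:: 8; 10; 11; 14; 15];
  [:: 2; 15; 16; 18]; [:: 6; 12; 16; 17]; [:: 13; 14; 17; 18]]%N.

Local Notation pnt i := (nth 0 Z i).
Local Notation lin k := (nth 0 lines12 k).
Local Notation inc k := (nth [::] incidences k).

Lemma incident_pt (a b c u v w : K) :
  incident (pt a b c) (pt u v w)^T = (a * u + b * v + c * w == 0) :> bool.
Proof.
have -> : a * u + b * v + c * w = (pt a b c *m (pt u v w)^T) 0 0.
  by rewrite mxE !big_ord_recl big_ord0 !mxE /= addr0 addrA.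
apply/eqP/eqP => [->|e]; first by rewrite mxE.
by apply/matrixP => i j; rewrite !ord1 e mxE.
Qed.

Lemma incidences_ok k i : (k < 12)%N -> i \in inc k -> incident (pnt i) (lin k).
Proof.
have : all (fun k => all (fun i => incident (pnt i) (lin k)) (inc k)) (iota 0 12).
  rewrite /= !incident_pt; do ?[apply/andP; split=> //]; apply/eqP; ring.
by move/allP => h k12; move: i; apply/allP; apply: h; rewrite mem_iota.
Qed.

Lemma lines12_neq0 k : (k < 12)%N -> lin k != 0.
Proof.
have pt_neq0 (a b c : K) : [|| a != 0, b != 0 | c != 0] -> (pt a b c)^T != 0 :> 'cV[K]_3.
  apply: contraTneq => /colP e.
  move: (e (@Ordinal 3 0 isT)) (e (@Ordinal 3 1 isT)) (e (@Ordinal 3 2 isT)).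
  by rewrite !mxE /= => -> -> ->; rewrite eqxx.
move=> k12; have : all (fun c : 'cV[K]_3 => c != 0) lines12.
  rewrite /= !pt_neq0 ?oppr_eq0 ?oner_eq0 ?orbT //.
  have [->|] := eqVneq t 0; last by rewrite orbT.
  by rewrite expr0n /= !add0r oner_eq0.
by move/all_nthP; apply.
Qed.

Hypothesis ppZ : projective_points Z.
Hypothesis few : forall c : 'cV[K]_3, c != 0 ->
  (count (fun p => incident p c) Z <= 5)%N.

Lemma pnt_mem i : (i < 19)%N -> pnt i \in Z.
Proof. by move=> i19; apply: mem_nth. Qed.

Lemma pnt_not_proportional i j : (i < 19)%N -> (j < 19)%N -> i != j ->
  ~~ (pnt i <= pnt j)%MS.
Proof.
move=> i19 j19 ij; apply: (points_not_proportional ppZ); rewrite ?pnt_mem //.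
by rewrite nth_uniq // projective_points_uniq.
Qed.

Lemma few_indices c (s : seq nat) : c != 0 -> uniq s ->
  all (fun i => (i < 19)%N && incident (pnt i) c) s -> (size s <= 5)%N.
Proof.
move=> c0 us /allP sP; apply: leq_trans (few c0).
rewrite -(size_map (fun i => pnt i)) -size_filter; apply: uniq_leq_size.
  rewrite map_inj_in_uniq // => i j /sP/andP[i19 _] /sP/andP[j19 _] /eqP.
  by rewrite nth_uniq ?projective_points_uniq // => /eqP.
by move=> _ /mapP[i /sP/andP[i19 ic] ->]; rewrite mem_filter ic pnt_mem.
Qed.

Lemma inc_lt19 k i : i \in inc k -> (i < 19)%N.
Proof.
case: (ltnP k 12) => [k12|ge]; last by rewrite nth_default.
have : all (fun s => all (fun i => (i < 19)%N) s) incidences by [].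
by move/all_nthP => /(_ [::] k k12) /allP; apply.
Qed.

(** A sixth point is excluded by the bound on collinear points. *)
Lemma five_exact k i : (k < 9)%N -> (i < 19)%N ->
  incident (pnt i) (lin k) = (i \in inc k).
Proof.
move=> k9 i19; have k12 : (k < 12)%N by lia.
apply/idP/idP => [ik|]; last exact: incidences_ok.
apply: contraT => nik.
have /andP[uk /eqP sk] : uniq (inc k) && (size (inc k) == 5%N).
  have : all (fun s => uniq s && (size s == 5%N)) (take 9 incidences) by [].
  by move/all_nthP => /(_ [::] k k9); rewrite nth_take.
have := @few_indices (lin k) (i :: inc k) (lines12_neq0 k12).
rewrite /= nik uk sk ltnn => /(_ isT); apply.
rewrite i19 ik; apply/allP => j jk; by rewrite (inc_lt19 jk) incidences_ok.
Qed.

(** The points other than A, H, K.  For generic t they are the base points of a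
    pencil of quartics with three fibres that split into four lines, one fibre
    for each of A, H, K; three lines of the fibre meet in that point. *)
Definition base16 : seq nat :=
  [:: 1; 3; 11; 16; 2; 4; 8; 12; 5; 6; 9; 15; 13; 14; 17; 18]%N.

(** Another base point on NORS would be on one of BEGHO, DFHIR, HJLMN, CPQS, the
    fibre of H, and each of these meets NORS in one of O, R, N, S.  The two
    lines would then coincide and contain more than five points. *)
Lemma last_line_exact i : i \in base16 ->
  incident (pnt i) (lin 11) = (i \in inc 11).
Proof.
move=> ib; apply/idP/idP => [i11|]; last exact: incidences_ok.
apply: contraT => ni.
(* A base point i on line 11 and on line h, which meet in o, makes them equal. *)
have crossing h o : (h < 12)%N -> o \in inc h -> o \in inc 11 -> i \in inc h ->
    (5 < size (undup (inc 11 ++ inc h)))%N -> False.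
  move=> h12 oh o11 ih; apply/negP; rewrite -leqNgt.
  apply: (@few_indices (lin 11)); rewrite ?lines12_neq0 ?undup_uniq //.
  have o19 := inc_lt19 oh; have i19 := inc_lt19 ih.
  apply/allP => j; rewrite mem_undup mem_cat => /orP[j11|jh].
    by rewrite (inc_lt19 j11) incidences_ok.
  rewrite (inc_lt19 jh) /=.
  have nio : ~~ (pnt i <= pnt o)%MS.
    by apply: pnt_not_proportional => //; apply: contraNneq ni => ->.
  apply: (two_points_line (lines12_neq0 h12) (ppZ.2 _ (pnt_mem o19)) nio _ _ i11);
    exact: incidences_ok.
have : all (fun i => [|| i \in inc 11, i \in inc 4, i \in inc 6, i \in inc 7
  | i \in inc 9]) base16 by [].
move/allP => /(_ i ib); rewrite (negbTE ni) orFb => /or4P[] ih.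
- by have := @crossing 4%N 14%N isT isT isT ih isT.
- by have := @crossing 6%N 17%N isT isT isT ih isT.
- by have := @crossing 7%N 13%N isT isT isT ih isT.
- by have := @crossing 9%N 18%N isT isT isT ih isT.
Qed.

(** ABDLQ, ACEIM, AFGJP and NORS: the fibre of A. *)
Definition fibre (j : 'I_4) : nat := nth 0%N [:: 0; 1; 2; 11]%N j.

Lemma fibre_exact i j : i \in base16 ->
  incident (pnt i) (lin (fibre j)) = (i \in inc (fibre j)).
Proof.
move=> ib; have i19 : (i < 19)%N.
  by have : all (fun i => (i < 19)%N) base16 by []; move/allP; apply.
case: j => [[|[|[|[|//]]]] jlt]; last exact: last_line_exact;
  exact: five_exact.
Qed.

Lemma symbolic_degree m d f : symbolic_pow Z m f -> f \is d.-homog -> f != 0 ->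
  (4 * m <= d)%N.
Proof.
move=> Sf fd f0; pose B := [seq pnt i | i <- base16].
have b19 i : i \in base16 -> (i < 19)%N.
  by have : all (fun i => (i < 19)%N) base16 by []; move/allP; apply.
have BZ p : p \in B -> p \in Z.
  by move=> /mapP[i /b19 i19 ->]; apply: pnt_mem.
have ppB : projective_points B.
  split; last by move=> v /BZ; apply: ppZ.2.
  have [dZ _] := ppZ; rewrite /distinct_points -map_comp map_inj_in_uniq //.
  move=> i j /b19 i19 /b19 j19 /= e; apply/eqP; rewrite -(nth_uniq <<0 : 'rV[K]_3>>%MS _ _ dZ) ?size_map //.
  by rewrite !(nth_map 0) // e.
have := @lines_degree_bound K 4 (fun j => lin (fibre j)) B ppB _ _ _ d f (fun=> m) fd f0.
rewrite big_map big_const_seq iter_addn addn0 count_predT => h.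
suff : (m * 16 <= 4 * d)%N by lia.
apply: h => [j|p /mapP[i ib ->]|j|p /BZ]; last exact: Sf.
- by apply: lines12_neq0; case: j => [[|[|[|[|//]]]] jlt].
- under eq_bigr do rewrite fibre_exact //.
  rewrite !big_ord_recl big_ord0 /fibre /=.
  have : all (fun i => ((i \in inc 0) + ((i \in inc 1) + ((i \in inc 2) +
    ((i \in inc 11) + 0))) == 1)%N) base16 by [].
  by move/allP => /(_ i ib)/eqP.
- rewrite count_map (eq_in_count (a2 := fun i => i \in inc (fibre j))); last first.
    by move=> i ib /=; rewrite fibre_exact.
  by case: j => [[|[|[|[|//]]]] jlt].
Qed.

(** At least three of the twelve lines pass through each point. *)
Lemma symbolic_small_degree k : exists f, [/\ symbolic_pow Z (3 * k) f,
  f \is (12 * k).-homog & f != 0].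
Proof.
pose f := \prod_(c <- lines12) linform c; exists (f ^+ k); split.
- move=> p /(nthP 0)[i i19 <-]; apply: ideal_powX.
  apply: (@ideal_powW _ _ _ 3 (count (fun c => pnt i *m c == 0) lines12));
    last exact: prod_linform_pow.
  have -> : lines12 = [seq lin k | k <- iota 0 12] by [].
  rewrite count_map; apply: (@leq_trans (count (fun k => i \in inc k) (iota 0 12))).
    have : all (fun i => 3 <= count (fun k => i \in inc k) (iota 0 12))%N (iota 0 19) by [].
    by move/allP; apply; rewrite mem_iota.
  rewrite -!size_filter; apply: uniq_leq_size; first by rewrite filter_uniq ?iota_uniq.
  move=> j; rewrite !mem_filter => /andP[ij jI]; rewrite jI andbT.
  by apply: incidences_ok => //; move: jI; rewrite mem_iota.
- exact: dhomogMn (prod_linform_homog lines12).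
- rewrite expf_neq0 // prodf_seq_neq0; apply/allP => c /(nthP 0)[j j12 <-] /=.
  by rewrite linform_eq0 lines12_neq0.
Qed.
End Configuration.

(** * The two resurgences *)

Section Resurgences.
Variables (R : realType) (K : fieldType).

Lemma sup_eq (S : set R) x : ubound S x ->
  (forall y, y < x -> exists2 s, S s & y < s) -> sup S = x.
Proof.
move=> ubx appr; have [s0 Ss0 _] : exists2 s, S s & x - 1 < s.
  by apply: appr; rewrite ltrBlDr ltrDl ltr01.
have supS : has_sup S by split; [exists s0 | exists x].
apply/eqP; rewrite eq_le ge_sup //=; last by exists s0.
rewrite leNgt; apply/negP => /appr[s Ss]; rewrite ltNge.
by rewrite (sup_upper_bound supS).
Qed.

Lemma symbolic_powW (n : nat) (Z : seq 'rV[K]_n) a b : (a <= b)%N ->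
  symbolic_pow Z b `<=` symbolic_pow Z a.
Proof. by move=> ab f Sf v vZ; apply: (ideal_powW ab); apply: Sf. Qed.

Lemma hom_ideal_sub (n : nat) (J L : set {mpoly K[n]}) : hom_ideal J ->
  is_ideal L -> (forall d f, J f -> f \is d.-homog -> f != 0 -> L f) -> J `<=` L.
Proof.
move=> [iJ hJ] iL JL f Jf.
rewrite (@pihomog_partitionE _ _ mdeg (msize f) f (leqnn _)).
apply: ideal_sum => // d _.
have [->|nz] := eqVneq (pihomog mdeg d f) 0; first exact: ideal_zero.
by apply: (JL d) => //; [exact: hJ | exact: pihomogP].
Qed.

Lemma symbolic_sub_ideal (n : nat) (Z : seq 'rV[K]_n) m : (0 < m)%N ->
  symbolic_pow Z m `<=` points_ideal Z.
Proof.
move=> m0; apply: hom_ideal_sub; first exact: symbolic_pow_hom.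
  exact: points_ideal_ideal.
move=> d f Sf fd _; apply: (points_ideal_form fd) => p pZ.
apply: (@points_ideal_eval _ _ [:: p]); last exact: mem_head.
apply/ideal_pow1; first exact: points_ideal_ideal.
exact: (ideal_powW m0 (Sf p pZ)).
Qed.

Variable t : K.
Local Notation Z := (points19 t).
Local Notation I := (points_ideal Z).
Hypothesis dZ : distinct_points Z.
Hypothesis al : alpha I = 5%N.
Hypothesis om : omega I = 5%N.
Hypothesis rg : regularity I = 7%N.

Lemma ppZ19 : projective_points Z.
Proof. by split=> // v; apply: points19_neq0. Qed.

Lemma few19 (c : 'cV[K]_3) : c != 0 ->
  (count (fun p => incident p c) Z <= 5)%N.
Proof.
move=> c0; apply: line_few_points => //; first exact: ppZ19.
exact: omega_generated.
Qed.

Lemma symbolic_sub_pow19 m r : (r <= m)%N -> (5 * r + 4 <= 4 * m)%N ->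
  symbolic_pow Z m `<=` ideal_pow I r.
Proof.
move=> le_rm le_m.
have [F] : inhabited (presentation Z 5 (8 - 5)) by apply: presentation_of_regularity.
have interpZ e : (5 + (8 - 5) <= e + 2)%N -> interpolates Z e.
  exact: (interpolates_ge F ppZ19).
apply: hom_ideal_sub; first exact: symbolic_pow_hom.
  exact: ideal_pow_ideal.
move=> d f Sf fd f0.
have le_d := symbolic_degree ppZ19 few19 Sf fd f0.
apply: (symbolic_sub_pow F ppZ19 interpZ isT _ fd); first by lia.
exact: (symbolic_powW le_rm).
Qed.

(** The power I^r starts in degree 5 r, and rounding m up to a multiple of 3
    gives a form of I^(m) of degree at most 4 m + 12. *)
Lemma not_symbolic_sub_pow19 m r : (4 * m + 12 < 5 * r)%N ->
  ~ (symbolic_pow Z m `<=` ideal_pow I r).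
Proof.
move=> lt_mr sub.
have [f [Sf fd f0]] := symbolic_small_degree t (m %/ 3).+1.
have If : ideal_pow I r f.
  by apply: sub; apply: symbolic_powW Sf; lia.
have I5 : I `<=` degree_ge 5 by apply: alpha_degree_ge => //; apply: points_ideal_hom.
have := degree_ge_form (degree_ge_pow I5 If) fd f0; lia.
Qed.

Lemma resurgence19 : ~ (symbolic_pow Z 3 `<=` ideal_pow I 2) ->
  resurgence R Z = 3%:R / 2%:R.
Proof.
move=> n32; apply: sup_eq => [_ [m [r [m0 r0 nsub ->]]]|y lt_y]; last first.
  by exists (3%:R / 2%:R) => //; exists 3%N, 2%N.
rewrite ler_pdivrMr ?ltr0n // mulrAC ler_pdivlMr ?ltr0n // -!natrM ler_nat.
rewrite leqNgt; apply/negP => lt_mr; apply: nsub.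
(* For r >= 2, 2 m >= 3 r + 1 gives 4 m >= 6 r + 2 >= 5 r + 4. *)
have [r2|r1] := ltnP 1 r; first by apply: symbolic_sub_pow19; lia.
have -> : r = 1%N by lia.
move=> f Sf; apply/ideal_pow1; first exact: points_ideal_ideal.
exact: (symbolic_sub_ideal m0).
Qed.

Lemma asymptotic_resurgence19 : asymptotic_resurgence R Z = 5%:R / 4%:R.
Proof.
apply: sup_eq => [_ [m [r [m0 r0 [N nsub] ->]]]|y lt_y].
  rewrite ler_pdivrMr ?ltr0n // mulrAC ler_pdivlMr ?ltr0n // -!natrM ler_nat.
  rewrite leqNgt; apply/negP => lt_mr; apply: (nsub (N + 4)%N (leq_addr _ _)).
  by apply: symbolic_sub_pow19; nia.
(* The ratios (5 k - 1) / (4 k) lie in the set and tend to 5 / 4 from below. *)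
pose k := (Num.truncn (5%:R / 4%:R - y)^-1).+1.
have k_gt0 : (0 < k)%N by [].
have lt_k : (5%:R / 4%:R - y)^-1 < k%:R :> R.
  exact: truncnS_gt.
move: k k_gt0 lt_k => k k_gt0 lt_k.
have k0 : (0 : R) < k%:R by rewrite ltr0n.
exists ((5 * k - 1)%:R / (4 * k)%:R).
  exists (5 * k - 1)%N, (4 * k)%N; split=> //; do ?by lia.
  by exists 4%N => s le_s; apply: not_symbolic_sub_pow19; nia.
have d0 : 0 < 5%:R / 4%:R - y by rewrite subr_gt0.
have lt1 : 1 < k%:R * (5%:R / 4%:R - y).
  by rewrite -ltr_pdivrMr // mul1r.
rewrite ltr_pdivlMr ?ltr0n ?muln_gt0 // natrB ?natrM; last by lia.
nra.
Qed.
End Resurgences.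

Theorem theorem2p2 (R : realType) (K : fieldType) (t : K) :
  distinct_points (points19 t) ->
  alpha (points_ideal (points19 t)) = 5%N ->
  omega (points_ideal (points19 t)) = 5%N ->
  regularity (points_ideal (points19 t)) = 7%N ->
  ~ (symbolic_pow (points19 t) 3 `<=` ideal_pow (points_ideal (points19 t)) 2) ->
  resurgence R (points19 t) = 3%:R / 2%:R /\
  asymptotic_resurgence R (points19 t) = 5%:R / 4%:R.
Proof.
by move=> dZ al om rg n32; split; [exact: resurgence19 | exact: asymptotic_resurgence19].
Qed.
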